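(* We have (a) $$\frac{1}{1-t}+\frac{1}{1+y}\sum_{n=1}^\infty\left(\frac{1+yt}{1-t}\right)^{n+1}F_n^{(\mathrm{pk},\mathrm{des})}\left(\frac{(1+y)^2t}{(y+t)(1+yt)},\frac{y+t}{1+yt},z_1,z_2,\dots\right)x^n$$ $$=\sum_{k=0}^\infty t^k\prod_{i=1}^\infty\exp\left(\sum_{m_i=1}^\infty\frac{(z_ix^i)^{m_i}}{im_i}\sum_{d\mid i}\mu(d)\bigl(k(1-(-y)^{dm_i})\bigr)^{i/d}\right),$$ (b) $$\frac{1}{1-t}+\frac12\sum_{n=1}^\infty\left(\frac{1+t}{1-t}\right)^{n+1}F_n^{\mathrm{pk}}\left(\frac{4t}{(1+t)^2},z_1,z_2,\dots\right)x^n=\sum_{k=0}^\infty t^k\prod_{i=1}^\infty\left(\frac{1+z_ix^i}{1-z_ix^i}\right)^{g_{i,k}},$$ and (c) $$\frac{1}{1-t}+\sum_{n=1}^\infty\frac{F_n^{\mathrm{des}}(t,z_1,z_2,\dots)}{(1-t)^{n+1}}x^n=\sum_{k=0}^\infty t^k\prod_{i=1}^\infty\left(\frac{1}{1-z_ix^i}\right)^{f_{i,k}}.$$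
   Context: For a permutation $\pi=\pi(1)\cdots\pi(n)$ of $[n]=\{1,\dots,n\}$, $\mathrm{des}(\pi)$ is the number of descents, i.e. $i\in[n-1]$ with $\pi(i)>\pi(i+1)$; $\mathrm{pk}(\pi)$ is the number of peaks, i.e. $i\in\{2,\dots,n-1\}$ with $\pi(i-1)<\pi(i)>\pi(i+1)$; $N_i(\pi)$ is the number of cycles of length $i$ of $\pi$. $\mathfrak{S}_n$ is the set of all permutations of $[n]$. With variables $z_1,z_2,\dots$, put $$F_n^{(\mathrm{pk},\mathrm{des})}(y,t,z_1,z_2,\dots)=\sum_{\pi\in\mathfrak{S}_n}y^{\mathrm{pk}(\pi)+1}t^{\mathrm{des}(\pi)+1}\prod_{i=1}^\infty z_i^{N_i(\pi)},$$ $$F_n^{\mathrm{pk}}(t,z_1,z_2,\dots)=\sum_{\pi\in\mathfrak{S}_n}t^{\mathrm{pk}(\pi)+1}\prod_{i=1}^\infty z_i^{N_i(\pi)},\qquad F_n^{\mathrm{des}}(t,z_1,z_2,\dots)=\sum_{\pi\in\mathfrak{S}_n}t^{\mathrm{des}(\pi)+1}\prod_{i=1}^\infty z_i^{N_i(\pi)}.$$ Also $$f_{i,k}=\frac1i\sum_{d\mid i}\mu(d)k^{i/d},\qquad g_{i,k}=\frac1{2i}\sum_{\substack{d\mid i\\ d\text{ odd}}}\mu(d)(2k)^{i/d},$$ where $\mu$ is the number-theoretic Möbius function. The identities are between formal power series in $x$ and $t$; rational functions of $y,t$ are expanded as power series in $t$. *)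

(* Defs.v *)
From HB Require Import structures.
From mathcomp Require Import all_boot all_order all_algebra all_fingroup.
From mathcomp Require Import boolp classical_sets.
From mathcomp.multinomials Require Import monalg.

Set Implicit Arguments.
Unset Strict Implicit.
Unset Printing Implicit Defensive.

Import GRing.Theory Num.Theory.
Local Open Scope ring_scope.

Record fps (R : Type) := Fps { coefs : nat -> R }.

Notation "{ 'fps' R }" := (fps R) (at level 0, format "{ 'fps'  R }") : type_scope.
Notation "\fps_ n E" := (Fps (fun n => E))
  (at level 36, n name, E at level 36, format "\fps_ n  E") : ring_scope.

Lemma fpsP (R : Type) (f g : {fps R}) : coefs f =1 coefs g -> f = g.
Proof. by case: f g => [f] [g] /= /funext ->. Qed.

HB.instance Definition _ (R : Type) := gen_eqMixin {fps R}.
HB.instance Definition _ (R : Type) := gen_choiceMixin {fps R}.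

Section FpsRing.
Variable R : comNzRingType.
Implicit Types f g h : {fps R}.

Definition fps_add f g : {fps R} := \fps_n (coefs f n + coefs g n).
Definition fps_opp f : {fps R} := \fps_n (- coefs f n).
Definition fpsC (c : R) : {fps R} := \fps_n (if n == 0%N then c else 0).
Definition fpsX : {fps R} := \fps_n (n == 1%N)%:R.
Definition fps_mul f g : {fps R} :=
  \fps_n (\sum_(i < n.+1) coefs f i * coefs g (n - i)).

Fact fps_addA : associative fps_add.
Proof. by move=> f g h; apply: fpsP => n /=; rewrite addrA. Qed.
Fact fps_addC : commutative fps_add.
Proof. by move=> f g; apply: fpsP => n /=; rewrite addrC. Qed.
Fact fps_add0 : left_id (fpsC 0) fps_add.
Proof. by move=> f; apply: fpsP => n /=; rewrite if_same add0r. Qed.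
Fact fps_addN : left_inverse (fpsC 0) fps_opp fps_add.
Proof. by move=> f; apply: fpsP => n /=; rewrite if_same addNr. Qed.

HB.instance Definition _ :=
  GRing.isZmodule.Build {fps R} fps_addA fps_addC fps_add0 fps_addN.

Let trunc m f : {poly R} := \poly_(i < m.+1) coefs f i.

Let coef_trunc m f n : (n <= m)%N -> (trunc m f)`_n = coefs f n.
Proof. by move=> le_nm; rewrite coef_poly ltnS le_nm. Qed.

Let coefs_mul m f g n :
  (n <= m)%N -> coefs (fps_mul f g) n = (trunc m f * trunc m g)`_n.
Proof.
move=> le_nm; rewrite coefM /=; apply: eq_bigr => -[i /= lt_in] _.
by rewrite !coef_trunc // (leq_trans _ le_nm) ?leq_subr -1?ltnS.
Qed.

Fact fps_mulA : associative fps_mul.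
Proof.
move=> f g h; apply: fpsP => n.
transitivity ((trunc n f * trunc n g * trunc n h)`_n).
  rewrite -mulrA coefM; apply: eq_bigr => -[i /= lt_in] _.
  by rewrite coef_trunc // -coefs_mul ?leq_subr.
rewrite coefM; apply: eq_bigr => -[i /= lt_in] _.
by rewrite -coefs_mul // coef_trunc ?leq_subr.
Qed.

Fact fps_mulC : commutative fps_mul.
Proof. by move=> f g; apply: fpsP => n; rewrite !(@coefs_mul n) // mulrC. Qed.

Fact fps_mul1 : left_id (fpsC 1) fps_mul.
Proof.
move=> f; apply: fpsP => n /=; rewrite big_ord_recl /= subn0 mul1r.
by rewrite big1 ?addr0 // => i _; rewrite mul0r.
Qed.

Fact fps_mulD : left_distributive fps_mul fps_add.
Proof.
move=> f g h; apply: fpsP => n /=; rewrite -big_split /=.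
by apply: eq_bigr => i _; rewrite mulrDl.
Qed.

Fact fps_oner_neq0 : fpsC 1 != 0 :> {fps R}.
Proof.
by apply/eqP => /(congr1 (fun f => coefs f 0)) /eqP; rewrite /= oner_eq0.
Qed.

HB.instance Definition _ := GRing.Zmodule_isComNzRing.Build {fps R}
  fps_mulA fps_mulC fps_mul1 fps_mulD fps_oner_neq0.

(* The inverse is chosen classically, so that no unit-ring structure is needed
   on the coefficients and the construction can be iterated. *)
Definition fps_unit : pred {fps R} := fun f => `[< exists g, g * f = 1 >].
Definition fps_inv f : {fps R} := xget f [set g | g * f = 1]%classic.

Fact fps_mulV : {in fps_unit, left_inverse 1 fps_inv *%R}.
Proof. by move=> f /asboolP exV; apply: (xgetPex f exV). Qed.
Fact fps_unitP f g : g * f = 1 -> fps_unit f.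
Proof. by move=> gf1; apply/asboolP; exists g. Qed.
Fact fps_inv_out : {in [predC fps_unit], fps_inv =1 id}.
Proof.
move=> f /asboolPn nV; rewrite /fps_inv; case: xgetP => // g _ gf1.
by case: nV; exists g.
Qed.

HB.instance Definition _ := GRing.ComNzRing_hasMulInverse.Build {fps R}
  fps_mulV fps_unitP fps_inv_out.

End FpsRing.

Arguments fpsX {R}.

Notation "{ 'fps2' R }" := {fps {fps R}} (at level 0, format "{ 'fps2'  R }") : type_scope.

(* Here the outer variable is [x] and the inner one is [t]. *)
Section Fps2.
Variable R : comNzRingType.
Implicit Types (u F : nat -> {fps2 R}) (f l : {fps2 R}).

Definition fps2C (c : R) : {fps2 R} := fpsC (fpsC c).
Definition fpsx : {fps2 R} := fpsX.
Definition fpst : {fps2 R} := fpsC fpsX.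

(* The coefficient of [x ^ n t ^ k] in [f] is [coefs (coefs f n) k]; a sequence
   converges when each of these coefficients is eventually constant. *)
Definition fps2_cvg u l := forall n k, exists N, forall m, (N <= m)%N ->
  coefs (coefs (u m) n) k = coefs (coefs l n) k.

Definition fps2_lim u : {fps2 R} := xget 0 [set l | fps2_cvg u l]%classic.

Lemma fps2_limE u l : fps2_cvg u l -> fps2_lim u = l.
Proof.
move=> ul; have := xgetPex 0 (ex_intro [set l | fps2_cvg u l]%classic l ul).
rewrite -/(fps2_lim u) => ul'; apply: fpsP => n; apply: fpsP => k.
have [N Nl] := ul n k; have [N' Nl'] := ul' n k.
by rewrite -(Nl _ (leq_maxl N N')) -(Nl' _ (leq_maxr N N')).
Qed.

Definition fps2_sum a F := fps2_lim (fun N => \sum_(a <= n < N) F n).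
Definition fps2_prod a F := fps2_lim (fun N => \prod_(a <= n < N) F n).

End Fps2.

Arguments fpsx {R}.
Arguments fpst {R}.

Notation "\isum_ ( n >= a ) E" := (fps2_sum a (fun n => E))
  (at level 41, n name, a at level 60, E at level 41,
   format "\isum_ ( n  >=  a )  E") : ring_scope.
Notation "\iprod_ ( n >= a ) E" := (fps2_prod a (fun n => E))
  (at level 36, n name, a at level 60, E at level 36,
   format "\iprod_ ( n  >=  a )  E") : ring_scope.

Section ExpPow.
Variable R : comNzRingType.
Implicit Types f : {fps2 R}.

(* Meaningful when [f] has zero constant term and [R] contains the rationals. *)
Definition fps2_exp f : {fps2 R} := \isum_(m >= 0) f ^+ m / m`!%:R.

Definition binq (a : rat) (j : nat) : rat := (\prod_(l < j) (a - l%:R)) / j`!%:R.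

(* Rational powers of a series with constant term 1, by the binomial series. *)
Definition fps2_pow f (a : rat) : {fps2 R} :=
  \isum_(j >= 0) ratr (binq a j) * (f - 1) ^+ j.

Lemma binq_nat n j : binq n%:R j = 'C(n, j)%:R.
Proof.
rewrite /binq; apply: (canLR (mulfK _)); first by rewrite pnatr_eq0 -lt0n fact_gt0.
rewrite -natrM bin_ffact ffact_prod natr_prod.
have [le_jn | lt_nj] := leqP j n.
  by apply: eq_bigr => i _; rewrite natrB // ltnW // (leq_trans (ltn_ord i)).
rewrite (bigD1 (Ordinal lt_nj)) //= subrr mul0r.
by rewrite (bigD1 (Ordinal lt_nj)) //= subnn mul0r.
Qed.

(* On natural exponents this is the usual power, whatever the constant term. *)
Lemma fps2_pow_nat f n : fps2_pow f n%:R = f ^+ n.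
Proof.
apply: fps2_limE => a b; exists n.+1 => m lt_nm.
suff -> : \sum_(0 <= j < m) ratr (binq n%:R j) * (f - 1) ^+ j = f ^+ n by [].
rewrite (big_cat_nat (n := n.+1)) //= [X in _ + X]big_nat_cond.
rewrite [X in _ + X]big1 => [|j /andP[/andP[lt_nj _] _]]; last first.
  by rewrite binq_nat bin_small // ratr_nat mul0r.
rewrite addr0 -{2}(subrK 1 f) exprDn big_mkord (reindex_inj rev_ord_inj) /=.
apply: eq_bigr => j _; rewrite expr1n mulr1 subSS binq_nat ratr_nat mulr_natl.
by rewrite bin_sub // -ltnS.
Qed.

End ExpPow.

Notation "f ^^ a" := (fps2_pow f a) (at level 29, left associativity) : ring_scope.

Section Statistics.
Variable n : nat.
Implicit Types s : 'S_n.
Local Open Scope nat_scope.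

Definition des s : nat :=
  #|[set i : 'I_n | [exists j : 'I_n, (j == i.+1 :> nat) && (s j < s i)]]|.

Definition pk s : nat :=
  #|[set i : 'I_n | [exists h : 'I_n, [exists j : 'I_n,
      [&& i == h.+1 :> nat, j == i.+1 :> nat, s h < s i & s j < s i]]]]|.

Definition ncycles (i : nat) s : nat := #|[set c in porbits s | #|c| == i]|.

End Statistics.

(* The polynomials F_n, as polynomial functions on a commutative ring; a
   permutation of [n] points has no cycle of length greater than [n]. *)
Section Fpolynomials.
Variables (A : comNzRingType) (n : nat).
Implicit Types (y t : A) (z : nat -> A).

Definition cycle_weight z (s : 'S_n) : A :=
  \prod_(1 <= i < n.+1) z i ^+ ncycles i s.

Definition Fpkdes y t z : A :=
  \sum_(s : 'S_n) y ^+ (pk s).+1 * t ^+ (des s).+1 * cycle_weight z s.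
Definition Fpk t z : A := \sum_(s : 'S_n) t ^+ (pk s).+1 * cycle_weight z s.
Definition Fdes t z : A := \sum_(s : 'S_n) t ^+ (des s).+1 * cycle_weight z s.

End Fpolynomials.

Definition moebius (n : nat) : int :=
  if all (fun p => logn p n == 1%N) (primes n) then (-1) ^+ size (primes n) else 0.

Definition fexpo (i k : nat) : rat :=
  i%:R^-1 * \sum_(d <- divisors i) (moebius d)%:~R * k%:R ^+ (i %/ d).
Definition gexpo (i k : nat) : rat :=
  (2 * i)%:R^-1 *
  \sum_(d <- divisors i | odd d) (moebius d)%:~R * (2 * k)%:R ^+ (i %/ d).

(* [K[z_0, z_1, z_2, ...]], with [<<U_(i)>>] as the variable [z_i]; [z_0] is
   not used. *)
Notation zpoly K := {malg K[{cmonom nat}]}.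
Notation ratfun := {fraction {poly rat}}.

Definition yvar : {fps2 (zpoly ratfun)} := fps2C (malgC (tofrac 'X)).
Definition zvar (K : comNzRingType) (i : nat) : {fps2 (zpoly K)} :=
  fps2C << ucm i >>.
Arguments zvar {K} i.

(* Main.v *)
From HB Require Import structures.
Require Import Defs.
From mathcomp Require Import all_boot all_order all_algebra all_fingroup.
From mathcomp.multinomials Require Import monalg.
From mathcomp Require Import boolp.
From mathcomp Require Import cyclic ring zify.

Set Implicit Arguments.
Unset Strict Implicit.
Unset Printing Implicit Defensive.

Import GRing.Theory Num.Theory.
Local Open Scope ring_scope.

(** Each side of the three identities is shown to be the generating function
    [\fps_ n \fps_ k signed_sum y z n k] of words of length [n] in [k] positive
    letters of weight [1] and [k] negative letters of weight [y], weighted by the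
    cycle type of their standardization; here [y] is the variable, [1] or [0].

    Left-hand sides. Fix a permutation [s] of [n] points. A word has
    standardization [s] when, read in the order given by [s], its letters
    increase weakly, a positive letter being repeated only at an ascent and a
    negative one only at a descent ([is_std_chain]). Adding the letters one at a
    time multiplies the generating function of these words, up to [1 - t], by
    [1 + y t], [y + t], [1 + y] or [t (1 + y)], according to the last two steps
    ([chain_transfer]). Counting the steps of each kind gives
    [t^(pk + 1) (1 + y)^(2 pk + 1) (y + t)^(des - pk) (1 + y t)^(n - 1 - des - pk)
    / (1 - t)^(n + 1)], which the changes of variables turn into the terms of the
    statement ([pkdes_gf], [pk_gf], [des_gf]).

    Right-hand sides. These rest on a signed form of the Gessel-Reutenauer
    theorem ([word_sum_rec]). Let [s] be the standardization of a word, and attach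
    to each position the periodic word read along its cycle. The positions are
    sorted by these readings, for the lexicographic order in which a negative
    letter reverses later comparisons ([lex_code_mono]). As in the
    Burrows-Wheeler transform, the multiset of the readings therefore determines
    the word ([rword_inj]), and a count shows that every multiset of necklaces
    arises ([readings_image]). After a full turn around a necklace of length [l],
    the positions with a given reading come back in the same order, or in the
    reverse order if the necklace has an odd number of negative letters. Hence an
    even necklace of multiplicity [M] yields [M] cycles of length [l], and an odd
    one [M %% 2] cycles of length [l] and [M %/ 2] cycles of length [2 l]
    ([prod_cycles_over]).

    The word enumerator is thus the product over the necklaces of explicit
    rational series. Its logarithmic derivative is a sum over primitive words,
    which Moebius inversion expresses by the power sums [k (1 - (- y)^m)] of the
    alphabet ([period_sumE]). The infinite products of the statement have the same
    logarithmic derivative; as they also have constant term [1] and the integers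
    are invertible, they coincide with the enumerator ([coefs_iprod_words]). *)

(** * Power series *)

Section Series.
Variable R : comNzRingType.
Implicit Types (f g h : {fps R}) (c : R) (n : nat).

Lemma coefsD f g n : coefs (f + g) n = coefs f n + coefs g n.
Proof. by []. Qed.

Lemma coefsN f n : coefs (- f) n = - coefs f n.
Proof. by []. Qed.

Lemma coefs0 n : coefs (0 : {fps R}) n = 0.
Proof. by rewrite /= if_same. Qed.

Lemma coefs1 n : coefs (1 : {fps R}) n = (n == 0%N)%:R.
Proof. by rewrite /=; case: eqP. Qed.

Lemma coefsM f g n :
  coefs (f * g) n = \sum_(i < n.+1) coefs f i * coefs g (n - i).
Proof. by []. Qed.

Lemma coefs_sum I r (P : pred I) (F : I -> {fps R}) n :
  coefs (\sum_(i <- r | P i) F i) n = \sum_(i <- r | P i) coefs (F i) n.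
Proof.
elim/big_rec2: _ => [|i f g _ <-]; first exact: coefs0.
by rewrite coefsD.
Qed.

Fact fpsC_zmod : zmod_morphism (@fpsC R).
Proof. by move=> a b; apply: fpsP => n; rewrite /=; case: eqP; rewrite ?subr0. Qed.
HB.instance Definition _ := GRing.isZmodMorphism.Build R {fps R} (@fpsC R) fpsC_zmod.

Lemma coefsCM c f n : coefs (fpsC c * f) n = c * coefs f n.
Proof.
rewrite coefsM big_ord_recl /= subn0 big1 ?addr0 // => i _.
by rewrite mul0r.
Qed.

Fact fpsC_monoid : monoid_morphism (@fpsC R).
Proof.
split=> // a b; apply: fpsP => n; rewrite coefsCM /=.
by case: eqP; rewrite ?mulr0.
Qed.
HB.instance Definition _ := GRing.isMonoidMorphism.Build R {fps R} (@fpsC R) fpsC_monoid.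

Lemma fpsC_nat n : fpsC n%:R = n%:R :> {fps R}.
Proof. exact: rmorph_nat. Qed.

Lemma coefs_natM i f n : coefs (i%:R * f) n = i%:R * coefs f n.
Proof. by rewrite -fpsC_nat coefsCM. Qed.

Lemma coefsXM f n : coefs (fpsX * f) n = if n is n'.+1 then coefs f n' else 0.
Proof.
rewrite coefsM; case: n => [|n]; first by rewrite big_ord1 /= mul0r.
rewrite big_ord_recl /= mul0r add0r big_ord_recl /= mul1r subn1 /=.
by rewrite big1 ?addr0 // => i _; rewrite mul0r.
Qed.

Lemma coefsXnM i f n :
  coefs (fpsX ^+ i * f) n = if (i <= n)%N then coefs f (n - i) else 0.
Proof.
elim: i n => [|i IHi] n; first by rewrite mul1r subn0.
by rewrite exprS -mulrA coefsXM; case: n => // n; rewrite IHi ltnS subSS.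
Qed.

Lemma coefsXn i n : coefs (fpsX ^+ i : {fps R}) n = (n == i)%:R.
Proof.
rewrite -[_ ^+ _]mulr1 coefsXnM coefs1; case: ltngtP => [lt|lt|->] //.
  by rewrite subn_eq0 leqNgt lt.
by rewrite subnn.
Qed.

(** Congruence modulo [X ^ n.+1]: the coefficient of index [n] is included. *)
Definition eqmodX n f g := forall j, (j <= n)%N -> coefs f j = coefs g j.

Lemma eqmodXW m n f g : (m <= n)%N -> eqmodX n f g -> eqmodX m f g.
Proof. by move=> le_mn fg j le_jm; apply/fg/(leq_trans le_jm). Qed.

Lemma eqmodX_mul n f f' g g' :
  eqmodX n f f' -> eqmodX n g g' -> eqmodX n (f * g) (f' * g').
Proof.
move=> ff' gg' j le_jn; rewrite !coefsM; apply: eq_bigr => i _.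
have le_ij : (i <= j)%N by rewrite -ltnS.
by rewrite ff' ?gg' // ?(leq_trans _ le_jn) ?leq_subr.
Qed.

Lemma eqmodX_prod n I r (P : pred I) (F G : I -> {fps R}) :
  (forall i, P i -> eqmodX n (F i) (G i)) ->
  eqmodX n (\prod_(i <- r | P i) F i) (\prod_(i <- r | P i) G i).
Proof. by move=> FG; elim/big_rec2: _ => // i f g /FG; apply: eqmodX_mul. Qed.

Definition ordX n f := forall j, (j < n)%N -> coefs f j = 0.

Lemma ordX_mul m n f g : ordX m f -> ordX n g -> ordX (m + n) (f * g).
Proof.
move=> fm gn j lt_j; rewrite coefsM big1 // => i _.
have [lt_im|le_mi] := ltnP i m; first by rewrite fm ?mul0r.
by rewrite (gn (j - i)%N) ?mulr0 //; have := ltn_ord i; lia.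
Qed.

Lemma ordX_mulr m f g : ordX m g -> ordX m (f * g).
Proof. by rewrite -[m]add0n => gm; apply: ordX_mul. Qed.

Lemma ordX_exp n f i : ordX n f -> ordX (n * i) (f ^+ i).
Proof.
move=> fn; elim: i => [|i IHi]; first by rewrite muln0.
by rewrite exprS mulnS; apply: ordX_mul.
Qed.

Lemma ordX_Xn n : ordX n (fpsX ^+ n).
Proof. by move=> j lt_jn; rewrite coefsXn ltn_eqF. Qed.

(** The Euler derivation [X d/dX] has the advantage over [d/dX] of acting
    diagonally on the coefficients. *)
Definition euler f : {fps R} := \fps_n (n%:R * coefs f n).

Lemma eulerD f g : euler (f + g) = euler f + euler g.
Proof. by apply: fpsP => n /=; rewrite mulrDr. Qed.

Lemma euler_sum I r (P : pred I) (F : I -> {fps R}) :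
  euler (\sum_(i <- r | P i) F i) = \sum_(i <- r | P i) euler (F i).
Proof.
apply: fpsP => n; rewrite /= !coefs_sum mulr_sumr.
by apply: eq_bigr.
Qed.

Lemma eulerM f g : euler (f * g) = euler f * g + f * euler g.
Proof.
apply: fpsP => n; rewrite coefsD /= mulr_sumr -big_split /=.
apply: eq_bigr => i _.
have -> : n%:R = i%:R + (n - i)%:R :> R by rewrite -natrD subnKC // -ltnS.
by ring.
Qed.

Lemma euler_C c : euler (fpsC c) = 0.
Proof.
by apply: fpsP => n; rewrite coefs0 /=; case: eqP => [->|_]; rewrite ?mul0r ?mulr0.
Qed.

Lemma euler1 : euler 1 = 0. Proof. exact: euler_C. Qed.

Lemma eulerCM c f : euler (fpsC c * f) = fpsC c * euler f.
Proof. by rewrite eulerM euler_C mul0r add0r. Qed.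

Lemma euler_Xn i : euler (fpsX ^+ i) = i%:R * fpsX ^+ i.
Proof.
apply: fpsP => n; rewrite coefs_natM /= coefsXn.
by case: eqP => [->|_]; rewrite ?mulr0.
Qed.

Lemma euler_exp f i : euler (f ^+ i.+1) = i.+1%:R * f ^+ i * euler f.
Proof.
elim: i => [|i IHi]; first by rewrite expr0 !mul1r.
rewrite exprS eulerM IHi -[i.+2]addn1 natrD !exprS; ring.
Qed.

(** [E] is the logarithmic derivative of [F], stated without a quotient. *)
Definition logd F E := euler F = E * F.

Lemma logd_mul f g e e' : logd f e -> logd g e' -> logd (f * g) (e + e').
Proof. by rewrite /logd eulerM => -> ->; ring. Qed.

Lemma logd_prod I r (P : pred I) (F E : I -> {fps R}) :
  (forall i, P i -> logd (F i) (E i)) ->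
  logd (\prod_(i <- r | P i) F i) (\sum_(i <- r | P i) E i).
Proof.
move=> FE; elim/big_rec2: _ => [|i e f Pi fe]; last exact: logd_mul (FE i Pi) fe.
by rewrite /logd euler1 mul0r.
Qed.

Lemma coefs_logd f e n : logd f e ->
  n%:R * coefs f n = \sum_(i < n.+1) coefs e i * coefs f (n - i).
Proof. by move=> /(congr1 (fun h => coefs h n)). Qed.

(** The geometric series [1 / (1 - c X ^ l)]. *)
Definition geo c l : {fps R} := \fps_n (if (l %| n)%N then c ^+ (n %/ l) else 0).

Lemma geo_inv c l : (0 < l)%N -> geo c l * (1 - fpsC c * fpsX ^+ l) = 1.
Proof.
move=> l_gt0; apply: fpsP => n.
rewrite mulrBr mulr1 mulrCA [geo _ _ * _]mulrC.
rewrite coefsD coefsN coefsCM coefsXnM coefs1 /=.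
case: leqP => [le_ln|lt_nl]; last first.
  case: n lt_nl => [|n] lt_nl; first by rewrite dvdn0 div0n mulr0 subr0.
  by rewrite gtnNdvd // mulr0 subrr.
have -> : (n == 0)%N = false by rewrite gtn_eqF // (leq_trans l_gt0).
rewrite -{1 2}(subnK le_ln) dvdn_addl ?dvdnn // divnDr ?dvdnn // divnn l_gt0 addn1.
by case: ifP; rewrite ?mulr0 ?subrr // exprS subrr.
Qed.

Lemma geo_unit c l : (0 < l)%N -> 1 - fpsC c * fpsX ^+ l \is a GRing.unit.
Proof. by move=> l_gt0; apply/unitrPr; exists (geo c l); rewrite mulrC geo_inv. Qed.

Lemma geoE c l : (0 < l)%N -> (1 - fpsC c * fpsX ^+ l)^-1 = geo c l.
Proof.
by move=> l_gt0; apply: (mulIr (geo_unit c l_gt0)); rewrite mulVr ?geo_unit ?geo_inv.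
Qed.

Lemma geoB1 c l : (0 < l)%N -> geo c l - 1 = fpsC c * fpsX ^+ l * geo c l.
Proof. by move=> l_gt0; rewrite -[in LHS](geo_inv c l_gt0); ring. Qed.

Lemma euler_geo_den c l :
  euler (1 - fpsC c * fpsX ^+ l) = - (l%:R * (fpsC c * fpsX ^+ l)).
Proof.
by rewrite -mulN1r eulerD euler1 add0r -(rmorphN1 (@fpsC R)) !eulerCM euler_Xn
           rmorphN1; ring.
Qed.

Lemma logd_geo c l : (0 < l)%N -> logd (geo c l) (l%:R * (geo c l - 1)).
Proof.
move=> l_gt0; rewrite /logd geoB1 //; have := geo_inv c l_gt0.
move=> gV; have /(congr1 (fun h => geo c l * euler h)) := gV.
rewrite /= euler1 mulr0 eulerM euler_geo_den mulrDr mulrCA gV mulr1.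
by move/(canRL (addrK _)) ->; ring.
Qed.

Lemma logd_geo_den c l :
  (0 < l)%N -> logd (1 - fpsC c * fpsX ^+ l) (- l%:R * (geo c l - 1)).
Proof.
move=> l_gt0; rewrite /logd euler_geo_den geoB1 //.
have gV := geo_inv c l_gt0; rewrite -[LHS]mulr1 -[X in _ * X = _]gV; ring.
Qed.

End Series.

(** * Limits *)

Section Limits.
Variable R : comNzRingType.
Notation A := {fps R}.
Implicit Types (F : nat -> {fps A}).

Lemma isum_coefs a F n : (forall m, (a <= m)%N -> ordX m (F m)) ->
  coefs (\isum_(m >= a) F m) n = \sum_(a <= m < n.+1) coefs (F m) n.
Proof.
move=> Ford; rewrite /fps2_sum.
rewrite (@fps2_limE _ _ (\fps_n \sum_(a <= m < n.+1) coefs (F m) n)) //.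
move=> i k; exists i.+1 => m lt_im; rewrite coefs_sum; congr coefs => /=.
have [le_ai|lt_ia] := leqP a i.+1.
  rewrite (big_cat_nat (n := i.+1)) //= [X in _ + X]big_nat_cond.
  rewrite [X in _ + X]big1 ?addr0 // => j /andP[/andP[lt_ij _] _].
  by apply: Ford => //; apply: leq_trans lt_ij.
rewrite [RHS]big_geq 1?ltnW // big_nat_cond big1 // => j /andP[/andP[le_aj _] _].
by apply: Ford => //; lia.
Qed.

Lemma prod_eqmod F j n : (forall m, (1 <= m)%N -> ordX m (F m - 1)) -> (j <= n)%N ->
  coefs (\prod_(1 <= m < n.+1) F m) j = coefs (\prod_(1 <= m < j.+1) F m) j.
Proof.
move=> Ford le_jn.
have -> : \prod_(1 <= i < n.+1) F i
    = (\prod_(1 <= i < j.+1) F i) * \prod_(j.+1 <= i < n.+1 | (j < i)%N) F i.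
  rewrite (big_cat_nat (n := j.+1)) //=; congr (_ * _).
  by rewrite big_nat_cond [RHS]big_nat_cond; apply: eq_bigl => i; case: (j < i)%N.
transitivity (coefs ((\prod_(1 <= i < j.+1) F i)
    * \prod_(j.+1 <= i < n.+1 | (j < i)%N) 1) j); last by rewrite big1_eq mulr1.
apply: (@eqmodX_mul _ j) => //; apply: eqmodX_prod => i lt_ji b le_b.
have := Ford i (leq_trans (ltn0Sn j) lt_ji) b (leq_ltn_trans le_b lt_ji).
by rewrite coefsD coefsN => /eqP; rewrite subr_eq0 => /eqP.
Qed.

Lemma iprod_coefs F n : (forall m, (1 <= m)%N -> ordX m (F m - 1)) ->
  coefs (\iprod_(m >= 1) F m) n = coefs (\prod_(1 <= m < n.+1) F m) n.
Proof.
move=> Ford; rewrite /fps2_prod.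
rewrite (@fps2_limE _ _ (\fps_n coefs (\prod_(1 <= m < n.+1) F m) n)) //.
by move=> i k; exists i.+1 => -[//|m] le_im; rewrite prod_eqmod.
Qed.

Lemma iprod_eqmod F n : (forall m, (1 <= m)%N -> ordX m (F m - 1)) ->
  eqmodX n (\iprod_(m >= 1) F m) (\prod_(1 <= m < n.+1) F m).
Proof. by move=> Ford j le_jn; rewrite iprod_coefs // prod_eqmod. Qed.

Lemma isum_eqmod a F n : (forall m, (a <= m)%N -> ordX m (F m)) ->
  eqmodX n (\isum_(m >= a) F m) (\sum_(a <= m < n.+1) F m).
Proof.
move=> Ford j le_jn; rewrite isum_coefs // coefs_sum.
have [le_aj|lt_ja] := leqP a j.+1; last first.
  rewrite big_geq 1?ltnW // big_nat_cond big1 // => i /andP[/andP[le_ai _] _].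
  by apply: Ford => //; lia.
rewrite [RHS](big_cat_nat (n := j.+1)) //= [X in _ = _ + X]big_nat_cond.
rewrite [X in _ = _ + X]big1 ?addr0 // => i /andP[/andP[lt_ij _] _].
by apply: Ford => //; apply: leq_trans lt_ij.
Qed.

End Limits.

(** * Moebius inversion *)

Lemma moebius_mulp p e : prime p -> (0 < e)%N ->
  moebius (p * e) = if (p %| e)%N then 0 else - moebius e.
Proof.
move=> p_pr e_gt0; have p_gt0 := prime_gt0 p_pr.
have primes_pe : primes (p * e) =i p :: primes e.
  by move=> r; rewrite primesM // inE primes_prime // inE.
have lognpe r : r \in primes (p * e) -> logn r (p * e) = ((r == p) + logn r e)%N.
  by rewrite mem_primes => /andP[r_pr _]; rewrite lognM // logn_prime.
rewrite /moebius; have [p_e | p'e] := boolP (p %| e)%N.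
  case: ifP => // /allP/(_ p).
  rewrite lognpe primes_pe mem_head // eqxx => /(_ isT).
  by rewrite eqSS eqn0Ngt logn_gt0 mem_primes p_pr e_gt0 p_e.
have p_notin : p \notin primes e by rewrite mem_primes p_pr e_gt0.
have uniq_pe : perm_eq (primes (p * e)) (p :: primes e).
  by apply: uniq_perm; rewrite ?primes_uniq //= p_notin primes_uniq.
rewrite (perm_all _ uniq_pe) (perm_size uniq_pe) /= lognpe ?primes_pe ?mem_head //.
rewrite eqxx (_ : logn p e = 0%N) /=; last first.
  by apply/eqP; rewrite eqn0Ngt logn_gt0.
rewrite (@eq_in_all _ _ (fun r => logn r e == 1%N)).
    by case: ifP; rewrite ?oppr0 // exprS mulN1r.
move=> r r_e; rewrite lognpe ?primes_pe ?inE ?r_e ?orbT //.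
by case: (r =P p) r_e p_notin => // -> ->.
Qed.

(** Toggling the factor [p] in a squarefree divisor changes the sign of its
    Moebius value. *)
Lemma sum_moebius n : (0 < n)%N -> \sum_(d <- divisors n) moebius d = (n == 1%N)%:R.
Proof.
move=> n_gt0; have [->|n_neq1] := eqVneq n 1%N.
  by rewrite (_ : divisors 1 = [:: 1%N]) // big_seq1.
set p := pdiv n; have p_pr : prime p by rewrite pdiv_prime //; lia.
have p_n : (p %| n)%N := pdiv_dvd n.
have p_gt0 := prime_gt0 p_pr.
have np_gt0 : (0 < n %/ p)%N by rewrite divn_gt0 // dvdn_leq.
rewrite (bigID (dvdn p)) /= -big_filter.
have -> : \sum_(d <- [seq d <- divisors n | (p %| d)%N]) moebius d
  = \sum_(e <- divisors (n %/ p)) moebius (p * e).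
  rewrite -(big_map (muln p) xpredT (moebius)); apply: perm_big; apply: uniq_perm.
  - exact/filter_uniq/divisors_uniq.
  - by rewrite map_inj_uniq ?divisors_uniq // => a b /eqP; rewrite eqn_pmul2l // => /eqP.
  move=> d; rewrite mem_filter -dvdn_divisors //; apply/andP/mapP.
    case=> /dvdnP[e ->] e_n; exists e; last by rewrite mulnC.
    by rewrite -dvdn_divisors // dvdn_divRL.
  case=> e; rewrite -dvdn_divisors // => e_np ->; rewrite dvdn_mulr //.
  by rewrite mulnC -dvdn_divRL.
rewrite (bigID (dvdn p)) /= [X in X + _ + _]big_seq_cond.
rewrite [X in X + _ + _]big1 => [|e]; last first.
  rewrite -dvdn_divisors // => /andP[e_np p_e].
  by rewrite moebius_mulp ?p_e // (dvdn_gt0 np_gt0).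
rewrite add0r [X in X + _]big_seq_cond (eq_bigr (fun e => - moebius e)) => [|e]; last first.
  rewrite -dvdn_divisors // => /andP[e_np /negPf p'e].
  by rewrite moebius_mulp ?p'e // (dvdn_gt0 np_gt0).
rewrite -big_seq_cond sumrN addrC; apply/eqP; rewrite subr_eq0; apply/eqP.
rewrite -[LHS]big_filter -[RHS]big_filter; apply: perm_big.
apply: uniq_perm; rewrite ?filter_uniq ?divisors_uniq //.
move=> d; rewrite !mem_filter -!dvdn_divisors //; case p'd: (p %| d)%N => //=.
have co_pd : coprime p d by rewrite prime_coprime // p'd.
rewrite -[in LHS](divnK p_n) mulnC Gauss_dvdr //.
by rewrite coprime_sym.
Qed.

(** The plethystic form of the classical inversion: along with the index, the
    degree of the power sums is rescaled by the divisors. *)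
Lemma moebius_inversion (R : pzRingType) (P : nat -> nat -> R) (Q : nat -> nat -> R) i m :
    (0 < i)%N -> (0 < m)%N ->
    (forall j l, (0 < l)%N -> (j %| i)%N ->
       P j l = \sum_(e <- divisors j) Q e (l * (j %/ e))%N) ->
  \sum_(d <- divisors i) (moebius d)%:~R * P (i %/ d)%N (d * m)%N = Q i m.
Proof.
move=> i_gt0 m_gt0 PQ.
transitivity (\sum_(d <- divisors i) \sum_(e <- divisors i | (d * e %| i)%N)
   (moebius d)%:~R * Q e (m * (i %/ e))%N).
  rewrite big_seq [RHS]big_seq; apply: eq_bigr => d.
  rewrite -dvdn_divisors // => d_i; have d_gt0 := dvdn_gt0 i_gt0 d_i.
  have id_gt0 : (0 < i %/ d)%N by rewrite divn_gt0 // dvdn_leq.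
  rewrite PQ ?muln_gt0 ?d_gt0 // ?dvdn_div // mulr_sumr.
  have -> : \sum_(e <- divisors i | (d * e %| i)%N) (moebius d)%:~R * Q e (m * (i %/ e))%N
     = \sum_(e <- divisors (i %/ d)) (moebius d)%:~R * Q e (m * (i %/ e))%N :> R.
    rewrite -big_filter; apply: perm_big; apply: uniq_perm.
    - exact/filter_uniq/divisors_uniq.
    - exact: divisors_uniq.
    move=> e; rewrite mem_filter -!dvdn_divisors // dvdn_divRL // mulnC.
    by case: (_ %| i)%N / idP => // de_i; apply: dvdn_trans (dvdn_mulr d (dvdnn e)) de_i.
  rewrite big_seq [RHS]big_seq; apply: eq_bigr => e.
  rewrite -dvdn_divisors // => e_id; congr (_ * Q e _).
  have e_i : (e %| i)%N := dvdn_trans e_id (dvdn_div d_i).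
  have e_gt0 := dvdn_gt0 i_gt0 e_i.
  rewrite [(d * m)%N]mulnC -mulnA; congr (m * _)%N.
  by rewrite muln_divA // [(d * _)%N]mulnC divnK.
rewrite (exchange_big_dep xpredT) //=.
rewrite (bigD1_seq i) ?divisors_uniq -?dvdn_divisors //=.
rewrite [X in _ + X]big_seq_cond [X in _ + X]big1 ?addr0 => [|e].
  rewrite divnn i_gt0 muln1 -mulr_suml -(rmorph_sum (intmul 1)) /=.
  have -> : \sum_(d <- divisors i | (d * i %| i)%N) moebius d = 1 ; last by rewrite mul1r.
  rewrite -big_filter (_ : [seq d <- divisors i | (d * i %| i)%N] = [:: 1%N]) ?big_seq1 //.
  apply: perm_small_eq => //; apply: uniq_perm; rewrite ?filter_uniq ?divisors_uniq //.
  move=> d; rewrite mem_filter inE -dvdn_divisors //; apply/andP/eqP.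
    by case=> di_i d_i; have := dvdn_leq i_gt0 di_i; have := dvdn_gt0 i_gt0 d_i; nia.
  by move=> ->; rewrite mul1n dvdnn dvd1n.
rewrite -dvdn_divisors // => /andP[e_i e_neq_i].
have e_gt0 := dvdn_gt0 i_gt0 e_i.
have ie_gt0 : (0 < i %/ e)%N by rewrite divn_gt0 // dvdn_leq.
rewrite -mulr_suml -(rmorph_sum (intmul 1)) /= -big_filter.
have -> : \sum_(d <- [seq d <- divisors i | (d * e %| i)%N]) moebius d
  = \sum_(d <- divisors (i %/ e)) moebius d.
  apply: perm_big; apply: uniq_perm; rewrite ?filter_uniq ?divisors_uniq //.
  move=> d; rewrite mem_filter -!dvdn_divisors // dvdn_divRL //.
  by case: (_ %| i)%N / idP => // de_i; apply: dvdn_trans (dvdn_mulr e (dvdnn d)) de_i.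
rewrite sum_moebius //.
case: eqP => [ie1|_]; last by rewrite mul0r.
by case/eqP: e_neq_i; rewrite -(divnK e_i) ie1 mul1n.
Qed.

(** * Standardization of words over a signed alphabet *)

Section Standardization.
Variables (n q : nat) (neg : pred 'I_q).
Implicit Types (v : 'I_n -> 'I_q) (s : 'S_n) (a b p : 'I_n).
Local Open Scope nat_scope.

(** Equal positive letters are ranked from left to right, equal negative ones
    from right to left. *)
Definition before v p a : bool :=
  (v p < v a) || (v p == v a) && (if neg (v p) then a < p else p < a).

Lemma before_irr v p : before v p p = false.
Proof. by rewrite /before !ltnn; case: ifP; rewrite andbF. Qed.

Lemma before_trans v : transitive (before v).
Proof.
move=> b a c; rewrite /before.
case/orP=> [lt_ab|/andP[/eqP -> o_ab]]; case/orP=> [lt_bc|/andP[/eqP <- o_bc]].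
- by rewrite (ltn_trans lt_ab lt_bc).
- by rewrite lt_ab.
- by rewrite lt_bc.
- by rewrite eqxx ltnn /=; case: ifP o_ab o_bc => _; lia.
Qed.

Lemma before_total v a b : a != b -> before v a b || before v b a.
Proof.
move=> neq_ab; rewrite /before [v b == v a]eq_sym.
have [_ //|_|/val_inj ->] := ltngtP (v a) (v b); first by rewrite orbT.
by rewrite eqxx /=; case: ifP => _; rewrite -neq_ltn // eq_sym.
Qed.

Definition earlier v p := [set a | before v a p].

Lemma card_earlier_lt v p : #|earlier v p| < n.
Proof.
rewrite -[X in _ < X]card_ord -cardsT; apply: proper_card.
rewrite properE subsetT /=; apply/subsetPn; exists p; rewrite ?inE //.
by rewrite before_irr.
Qed.

Lemma card_earlier_mono v a b : before v a b -> #|earlier v a| < #|earlier v b|.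
Proof.
move=> ab; apply: proper_card; rewrite properE; apply/andP; split.
  by apply/subsetP=> c; rewrite !inE => /before_trans; apply.
by apply/subsetPn; exists a; rewrite ?inE // before_irr.
Qed.

Definition rank v p := Ordinal (card_earlier_lt v p).

Lemma rank_inj v : injective (rank v).
Proof.
move=> a b /(congr1 val) /= eq_ab; apply/eqP; apply: contraTT isT.
by case/(before_total v)/orP => /card_earlier_mono; rewrite eq_ab ltnn.
Qed.

(** The positions of [v] listed in the order of their letters. This is the
    inverse of the usual standardization; both have the same cycle type. *)
Definition st v : 'S_n := ((perm (@rank_inj v))^-1)%g.

Definition is_std v s := [forall i : 'I_n, forall j : 'I_n, (i < j) ==> before v (s i) (s j)].

Lemma st_is_std v : is_std v (st v).
Proof.
apply/forallP=> i; apply/forallP=> j; apply/implyP=> lt_ij.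
have rank_st k : rank v (st v k) = k by rewrite -(permE (@rank_inj v)) permKV.
have neq_ij : st v i != st v j by rewrite (inj_eq perm_inj) neq_ltn lt_ij.
case/orP: (before_total v neq_ij) => // /card_earlier_mono.
have card_st k : #|earlier v (st v k)| = k by rewrite -[RHS](congr1 val (rank_st k)).
by rewrite !card_st ltnNge ltnW.
Qed.

(** As [before v] is total, only one listing of the positions is increasing. *)
Lemma st_eqP v s : reflect (st v = s) (is_std v s).
Proof.
apply: (iffP idP) => [s_std|<-]; last exact: st_is_std.
apply/permP=> i; apply: (@rank_inj v).
rewrite -[LHS](permE (@rank_inj v)) permKV; apply: val_inj => /=.
have -> : earlier v (s i) = s @: [set j : 'I_n | j < i].
  apply/setP=> p; rewrite -[p](permKV s) mem_imset ?inE; last exact: perm_inj.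
  move: (s^-1 p)%g => {p} j; have [lt_ji|lt_ij|/val_inj ->] := ltngtP j i.
  - by have /forallP/(_ j)/forallP/(_ i) := s_std; rewrite lt_ji.
  - apply: contraTF isT => ji.
    have /forallP/(_ i)/forallP/(_ j) := s_std; rewrite lt_ij /= => ij.
    by have := before_trans ji ij; rewrite before_irr.
  - by rewrite before_irr.
rewrite card_imset; last exact: perm_inj.
rewrite cardsE -sum1_card -(big_ord_widen _ (fun=> 1)) ?sum1_card ?card_ord //.
exact: ltnW.
Qed.

End Standardization.

(** * Words read along the cycles of a standardization *)

Section Words.
Variables (q : nat) (neg : pred 'I_q) (L : nat).
Local Open Scope nat_scope.

(** A word of length [L.+1] stands for its periodic repetition. *)
Definition pword := {ffun 'I_L.+1 -> 'I_q}.
Implicit Types (u : pword) (f g : nat -> 'I_q).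

Definition shift u : pword := [ffun j => u (ordS j)].

Lemma shift_inj : injective shift.
Proof.
move=> u u' /ffunP eq_uu'; apply/ffunP=> j.
by have := eq_uu' (ord_pred j); rewrite !ffunE ord_predK.
Qed.

Definition rotation : {perm pword} := perm shift_inj.

Lemma rotationE u j : rotation u j = u (ordS j). Proof. by rewrite permE ffunE. Qed.

Lemma rotationXE i u j : (rotation ^+ i)%g u j = u (inord ((j + i) %% L.+1)).
Proof.
elim: i u j => [|i IHi] u j.
  by rewrite expg0 perm1 addn0 modn_small // inord_val.
rewrite expgSr permM rotationE IHi /=; congr (u (inord _)).
by rewrite modnDml addSnnS.
Qed.

(** The signed lexicographic order, in which a negative letter reverses the
    comparison of what follows it, as an order between numbers in base [q]. *)
Fixpoint lex_code t f : nat :=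
  if t is t'.+1 then
    let r := lex_code t' (fun j => f j.+1) in
    f 0 * q ^ t' + (if neg (f 0) then (q ^ t').-1 - r else r)
  else 0.

Lemma lex_code_lt t f : lex_code t f < q ^ t.
Proof.
elim: t f => //= t IHt f; have := IHt (fun j => f j.+1).
have : (f 0).+1 * q ^ t <= q * q ^ t by rewrite leq_mul2r ltn_ord orbT.
rewrite -expnS mulSn; case: ifP => _; lia.
Qed.

Lemma lex_code_inj t f g : lex_code t f = lex_code t g -> forall j, j < t -> f j = g j.
Proof.
elim: t f g => //= t IHt f g.
have := lex_code_lt t (fun j => f j.+1); have := lex_code_lt t (fun j => g j.+1).
have [fE|] := eqVneq (f 0) (g 0).
  rewrite -fE => lt_g lt_f eq_fg.
  have eq_r : lex_code t (fun j => f j.+1) = lex_code t (fun j => g j.+1).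
    by move: eq_fg; case: ifP => _; lia.
  by move/IHt: eq_r => eq_r [|j] // /eq_r.
rewrite -val_eqE /= => neq_fg lt_g lt_f eq_fg.
set r := (if neg (f 0) then _ else _) in eq_fg.
set r' := (if neg (g 0) then _ else _) in eq_fg.
have lt_r : r < q ^ t by rewrite /r; case: ifP; lia.
have lt_r' : r' < q ^ t by rewrite /r'; case: ifP; lia.
by case/eqP: neq_fg; move: eq_fg lt_r lt_r'; clear; nia.
Qed.

Lemma lex_code_eq t f g : (forall j, j < t -> f j = g j) -> lex_code t f = lex_code t g.
Proof.
elim: t f g => //= t IHt f g fg; rewrite fg // (IHt _ (fun j => g j.+1)) // => j lt_jt.
exact: fg.
Qed.

Section Reading.
Variables (n : nat) (v : {ffun 'I_n -> 'I_q}).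
Hypothesis order_L : n`! %| L.+1.
Let s := st neg v.

(** The letters met along the cycle of [p], from [s p] on and up to [p] itself
    at index [L], as [L.+1] is a multiple of the length of the cycle. *)
Definition reading p j := v ((st neg v ^+ j.+1)%g p).
Definition rword p : pword := [ffun j : 'I_L.+1 => reading p j].

Lemma perm_order_L : (s ^+ L.+1 = 1)%g.
Proof.
apply/eqP; rewrite -order_dvdn; apply: dvdn_trans order_L.
by rewrite -card_Sn -cardsT; apply: (@order_dvdG _ [set: 'S_n]%G); rewrite inE.
Qed.

Lemma readingS p j : reading p j.+1 = reading (s p) j.
Proof. by rewrite /reading [in LHS]expgS permM. Qed.

Lemma readingE p j : reading p j = rword p (inord (j %% L.+1)).
Proof.
rewrite ffunE inordK ?ltn_mod // /reading !expgS !permM.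
by rewrite expg_mod // perm_order_L.
Qed.

Lemma rotation_rword p : rotation (rword p) = rword (s p).
Proof.
apply/ffunP=> j; rewrite rotationE [in RHS]ffunE -readingS readingE.
by congr (rword p _); apply: val_inj; rewrite /= inordK ?ltn_mod.
Qed.

Lemma rotationX_rword i p : (rotation ^+ i)%g (rword p) = rword ((s ^+ i)%g p).
Proof.
elim: i p => [|i IHi] p; first by rewrite !expg0 !perm1.
by rewrite !expgS !permM rotation_rword IHi.
Qed.

(** The Burrows-Wheeler property: positions are sorted by the words read
    from them. *)
Lemma lex_code_mono t (i j : 'I_n) : i < j -> lex_code t (reading i) <= lex_code t (reading j).
Proof.
elim: t i j => //= t IHt i j lt_ij.
have := lex_code_lt t (fun k => reading i k.+1); have := lex_code_lt t (fun k => reading j k.+1).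
have reS p : lex_code t (fun k => reading p k.+1) = lex_code t (reading (s p)).
  by apply: lex_code_eq => k _; rewrite readingS.
have : before neg v (s i) (s j).
  by have /forallP/(_ i)/forallP/(_ j) := st_is_std neg v; rewrite lt_ij.
have vs p : v (s p) = reading p 0 by rewrite /reading expg1.
rewrite /before !vs => /orP[lt_v|/andP[/eqP eq_v]].
  set r := if neg (reading i 0) then _ else _.
  set r' := if neg (reading j 0) then _ else _.
  move=> lt_j lt_i; have lt_r : r < q ^ t by rewrite /r; case: ifP; lia.
  by move: lt_r lt_v; clear; nia.
rewrite -eq_v !reS; case: ifP => _ /IHt; lia.
Qed.

End Reading.

(** A word is recovered from the multiset of its readings: sorting the
    readings assigns them to the positions, and the last letter of the reading
    from [p] is the letter at [p]. *)
Lemma rword_inj n (v v' : {ffun 'I_n -> 'I_q}) : n`! %| L.+1 ->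
  (forall u, #|[set p | rword v p == u]| = #|[set p | rword v' p == u]|) -> v = v'.
Proof.
move=> nL eq_m.
pose encw (u : pword) := lex_code L.+1 (fun j => u (inord j)).
have encwE (x : {ffun 'I_n -> 'I_q}) p : encw (rword x p) = lex_code L.+1 (reading x p).
  by apply: lex_code_eq => j lt_j; rewrite (readingE _ nL) modn_small.
have encw_inj : injective encw.
  move=> u u' /lex_code_inj eq_uu'; apply/ffunP=> j.
  by have := eq_uu' j (ltn_ord j); rewrite inord_val.
have sortedw (x : {ffun 'I_n -> 'I_q}) :
    sorted leq [seq encw u | u <- [seq rword x p | p <- enum 'I_n]].
  rewrite -map_comp; apply: (homo_sorted (e := fun i j : 'I_n => i < j)).
    by move=> i j lt_ij /=; rewrite !encwE; apply: lex_code_mono.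
  by rewrite -(sorted_map (f := val) (e' := ltn)) val_enum_ord iota_ltn_sorted.
have eq_seq : [seq rword v p | p <- enum 'I_n] = [seq rword v' p | p <- enum 'I_n].
  apply: (inj_map encw_inj); apply: (sorted_eq leq_trans anti_leq) => //.
  apply: perm_map; apply/allP=> u _ /=; rewrite (count_map (rword v)) (count_map (rword v')); apply/eqP.
  have cnt (x : {ffun 'I_n -> 'I_q}) :
      count (preim (rword x) (pred1 u)) (enum 'I_n) = #|[set p | rword x p == u]|.
    by rewrite -sum1_count big_enum_cond -sum1_card; apply: eq_bigl => p; rewrite inE.
  by rewrite !cnt eq_m.
apply/ffunP=> p; have /eq_in_map/(_ p) := eq_seq.
rewrite mem_enum => /(_ isT)/ffunP/(_ ord_max); rewrite !ffunE /reading /=.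
by rewrite !perm_order_L // !perm1.
Qed.

End Words.

(** * Cycle type of a standardization *)

Section Porbit.
Variables (T : finType) (s : {perm T}).
Implicit Types x y : T.

Lemma porbit_gt0 x : (0 < #|porbit s x|)%N.
Proof. by rewrite lt0n card_porbit_neq0. Qed.

Lemma porbit_size_fix x : (s ^+ #|porbit s x|)%g x = x.
Proof. by rewrite permX iter_porbit. Qed.

Lemma porbit_dvdP x i : ((s ^+ i)%g x == x) = (#|porbit s x| %| i)%N.
Proof.
set l := #|porbit s x|.
have fixX j : (s ^+ (j * l))%g x = x.
  by elim: j => [|j IHj]; rewrite ?mul0n ?expg0 ?perm1 // mulSn expgD permM porbit_size_fix.
rewrite {1}(divn_eq i l) expgD permM fixX /dvdn.
have lt_il : (i %% l < l)%N by rewrite ltn_mod porbit_gt0.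
rewrite -[RHS](nth_uniq x _ _ (uniq_traject_porbit s x)) ?size_traject ?porbit_gt0 //.
by rewrite !nth_traject ?porbit_gt0 //= permX.
Qed.

Lemma big_porbit (R : Type) (idx : R) (op : Monoid.com_law idx) x (F : T -> R) :
  \big[op/idx]_(y in porbit s x) F y = \big[op/idx]_(i < #|porbit s x|) F ((s ^+ i)%g x).
Proof.
rewrite (eq_bigl _ _ (porbit_traject s x)) -big_uniq ?uniq_traject_porbit //=.
rewrite (big_nth x) size_traject big_mkord; apply: eq_bigr => i _.
by rewrite nth_traject // permX.
Qed.

Lemma porbit_of x y : y \in porbit s x -> porbit s y = porbit s x.
Proof. by rewrite -eq_porbit_mem => /eqP. Qed.

Lemma mem_porbits x : porbit s x \in porbits s. Proof. exact: imset_f. Qed.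

Lemma porbits_partition : partition (porbits s) [set: T].
Proof.
apply/and3P; split.
- rewrite eqEsubset subsetT; apply/subsetP=> x _; apply/bigcupP.
  by exists (porbit s x); rewrite ?mem_porbits ?porbit_id.
- apply/trivIsetP=> _ _ /imsetP[x _ ->] /imsetP[y _ ->].
  apply: contraR => /pred0Pn[t /andP[/= /porbit_of <- /porbit_of <-]].
  by rewrite eqxx.
- by apply/imsetP=> -[x _ x0]; have := porbit_id s x; rewrite -x0 inE.
Qed.

End Porbit.

(** An equivariant map sends orbits onto orbits, here cycles onto necklaces. *)
Lemma porbit_morph (T T' : finType) (s : {perm T}) (s' : {perm T'}) (f : T -> T') x :
  (forall y, f (s y) = s' (f y)) -> f @: porbit s x = porbit s' (f x).
Proof.
move=> fs; have fX i y : f ((s ^+ i)%g y) = (s' ^+ i)%g (f y).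
  by elim: i y => [|i IHi] y; rewrite ?expg0 ?perm1 // !expgS !permM IHi fs.
apply/setP=> y; apply/imsetP/porbitP.
  by case=> _ /porbitP[i ->] ->; exists i; rewrite fX.
by case=> i ->; exists ((s ^+ i)%g x); rewrite ?mem_porbit ?fX.
Qed.

Lemma cycle_weight_porbits (A : comNzRingType) n (z : nat -> A) (s : 'S_n) :
  cycle_weight z s = \prod_(o in porbits s) z #|o|.
Proof.
have sizes_gt0 o : o \in porbits s -> (0 < #|o|)%N.
  by case/imsetP=> p _ ->; apply: porbit_gt0.
rewrite (partition_big (fun o : {set 'I_n} => inord #|o| : 'I_n.+1) xpredT) //=.
have lt_size (o : {set 'I_n}) : (#|o| < n.+1)%N by rewrite ltnS -[leqRHS]card_ord max_card.
rewrite big_ord_recl [X in _ = X * _]big1 ?mul1r => [|o /andP[/sizes_gt0 o_gt0]]; last first.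
  by rewrite -val_eqE /= inordK // eqn0Ngt o_gt0.
rewrite /cycle_weight big_add1 /= big_mkord; apply: eq_bigr => i _.
rewrite /ncycles -prodr_const; apply: eq_big => o.
  by rewrite inE -val_eqE /= inordK.
by rewrite inE => /andP[_ /eqP ->].
Qed.

(** A necklace is represented by the set of the rotations of its periodic word,
    that is, by an orbit of [rotation]. The letters of one period are the first
    letters of these rotations. *)
Definition odd_neck q (neg : pred 'I_q) L (c : {set pword q L}) : bool :=
  odd #|[set u in c | neg (u ord0)]|.

(** The weight of the cycles whose readings form a given necklace, of length [l],
    multiplicity [M] and parity [b]; see [prod_cycles_over]. *)
Definition neck_cycles (A : comNzRingType) (z : nat -> A) (b : bool) l M : A :=
  if b then z l ^+ odd M * z (2 * l)%N ^+ M./2 else z l ^+ M.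

Section CycleType.
Variables (q : nat) (neg : pred 'I_q) (L n : nat) (v : {ffun 'I_n -> 'I_q}).
Hypothesis order_L : (n`! %| L.+1)%N.
Local Notation s := (st neg v).
Local Notation rotation := (rotation q L).
Local Notation rword := (rword neg L v).
Local Notation reading := (reading neg v).

(** Two positions with the same reading move in parallel, and each negative
    letter that they meet exchanges their order. *)
Lemma reading_mono e (p p' : 'I_n) : (p < p')%N -> rword p = rword p' ->
  if odd (\sum_(i < e) neg (reading p i)) then ((s ^+ e)%g p' < (s ^+ e)%g p)%N
  else ((s ^+ e)%g p < (s ^+ e)%g p')%N.
Proof.
move=> lt_pp eq_pp; elim: e => [|e]; first by rewrite big_ord0 !expg0 !perm1.
rewrite big_ord_recr oddD /= !expgSr !permM.
have step (a b : 'I_n) : (a < b)%N -> reading a 0 = reading b 0 ->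
    if neg (reading a 0) then (s b < s a)%N else (s a < s b)%N.
  move=> lt_ab; have /forallP/(_ a)/forallP/(_ b) := st_is_std neg v.
  rewrite lt_ab /= /before /reading expg1 => ltv eqv; move: ltv.
  by rewrite -eqv ltnn eqxx.
have readX a : reading a e = reading ((s ^+ e)%g a) 0.
  by rewrite /reading expgSr permM expg1.
have eqE : reading ((s ^+ e)%g p) 0 = reading ((s ^+ e)%g p') 0.
  by rewrite -!readX !(readingE _ _ order_L) eq_pp.
rewrite readX oddb.
case: (odd _) => /step; rewrite ?eqE => /(_ erefl); by case: (neg _).
Qed.

(** The power [s ^+ e] preserves the order of the positions with the same reading
    as [p]. If it moved [p] up, its iterates would move [p] up forever. *)
Lemma reading_fix e p : ~~ odd (\sum_(i < e) neg (reading p i)) ->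
  rword ((s ^+ e)%g p) = rword p -> (s ^+ e)%g p = p.
Proof.
move=> even_p eq_p; set g := (s ^+ e)%g; have eqX j : rword ((g ^+ j)%g p) = rword p.
  elim: j => [|j IHj]; first by rewrite expg0 perm1.
  by rewrite expgSr permM -(rotationX_rword _ _ order_L) IHj (rotationX_rword _ _ order_L).
have monoX (a b : 'I_n) : rword a = rword p -> rword b = rword p -> (a < b)%N -> (g a < g b)%N.
  move=> eq_a eq_b lt_ab; have := @reading_mono e a b lt_ab.
  rewrite (eq_bigr (fun i : 'I_e => neg (reading p i) : nat)) => [|i _]; last first.
    by rewrite !(readingE _ _ order_L) eq_a.
  by rewrite (negPf even_p) eq_a eq_b; apply.
have gX j : (g ^+ j.+1)%g p = g ((g ^+ j)%g p) by rewrite expgSr permM.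
have [k gk] : exists k, (g ^+ k.+1)%g p = p.
  by exists #[g]%g.-1; rewrite prednK ?order_gt0 // expg_order perm1.
have eq_g : rword (g p) = rword p by rewrite -{1}[g]expg1.
have [lt_p|lt_p|] := ltngtP (g p) p; last exact: val_inj.
  have lt_j j : ((g ^+ j.+1)%g p < p)%N.
    by elim: j => [|j IHj]; rewrite ?expg1 // gX (ltn_trans (monoX _ _ _ _ IHj)).
  by have := lt_j k; rewrite gk ltnn.
have lt_j j : (p < (g ^+ j.+1)%g p)%N.
  by elim: j => [|j IHj]; rewrite ?expg1 // gX (ltn_trans lt_p) // monoX.
by have := lt_j k; rewrite gk ltnn.
Qed.

Let neck p := porbit rotation (rword p).

Lemma reading_shift i j p : reading p (i + j) = reading ((s ^+ i)%g p) j.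
Proof. by rewrite /reading -addnS expgD permM. Qed.

Lemma odd_neckE p :
  odd_neck neg (neck p) = odd (\sum_(i < #|neck p|) neg (reading p i)).
Proof.
rewrite /odd_neck -sum1dep_card big_mkcondr big_porbit; congr (odd _).
apply: eq_bigr => i _; rewrite (rotationX_rword _ _ order_L).
have -> : rword ((s ^+ i)%g p) ord0 = reading p i by rewrite ffunE -reading_shift addn0.
by case: (neg _).
Qed.

Lemma cycle_size_dvd p : (#|neck p| %| #|porbit s p|)%N.
Proof. by rewrite -porbit_dvdP (rotationX_rword _ _ order_L) porbit_size_fix. Qed.

Lemma rword_neck_fix p : rword ((s ^+ #|neck p|)%g p) = rword p.
Proof. by rewrite -(rotationX_rword _ _ order_L) porbit_size_fix. Qed.

Lemma cycle_size_even p : ~~ odd_neck neg (neck p) -> #|porbit s p| = #|neck p|.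
Proof.
rewrite odd_neckE => even_p; apply/eqP; rewrite eqn_dvd cycle_size_dvd andbT.
by rewrite -porbit_dvdP reading_fix // rword_neck_fix.
Qed.

(** One turn around an odd necklace reverses the order of the positions with a
    given reading; two turns restore it. *)
Lemma cycle_size_odd p : odd_neck neg (neck p) ->
  (#|porbit s p| == #|neck p|) || (#|porbit s p| == 2 * #|neck p|)%N.
Proof.
rewrite odd_neckE => odd_p; have dvd2 : (#|porbit s p| %| 2 * #|neck p|)%N.
  rewrite -porbit_dvdP mul2n -addnn; apply/eqP/reading_fix.
    rewrite big_split_ord oddD /=.
    rewrite [X in odd _ (+) odd X](eq_bigr (fun i : 'I__ => neg (reading p i) : nat)) ?addbb // => i _.
    rewrite reading_shift !(readingE _ _ order_L).
    by rewrite rword_neck_fix.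
  by rewrite expgD permM -(rotationX_rword _ _ order_L) rword_neck_fix porbit_size_fix.
have /dvdnP[k def_p] := cycle_size_dvd p.
have neck_gt0 := porbit_gt0 rotation (rword p).
rewrite def_p dvdn_pmul2r // in dvd2 *; rewrite -{2}[#|neck p|]mul1n !eqn_pmul2r //.
by case: k dvd2 {def_p} => [|[|[|k]]] // /dvdn_leq; apply.
Qed.

(** Each rotation of a necklace is read equally often ([card_rword_rotation]), so
    the division is exact. *)
Definition neck_mult (c : {set pword q L}) : nat := #|[set p | rword p \in c]| %/ #|c|.

(** [s] maps the positions with reading [u] onto those with the rotated reading. *)
Lemma card_rword_rotation u i :
  #|[set p | rword p == (rotation ^+ i)%g u]| = #|[set p | rword p == u]|.
Proof.
rewrite -[RHS](card_imset _ (@perm_inj _ (s ^+ i)%g)); apply: eq_card => p.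
rewrite -[p](permKV (s ^+ i)%g) mem_imset ?inE; last exact: perm_inj.
by rewrite -(rotationX_rword _ _ order_L) (inj_eq perm_inj).
Qed.

Lemma card_rword_in c : c \in porbits rotation -> forall u, u \in c ->
  #|[set p | rword p \in c]| = (#|c| * #|[set p | rword p == u]|)%N.
Proof.
case/imsetP=> u0 _ ->{c} u u_c.
rewrite -sum_nat_const -sum1dep_card (partition_big rword (mem (porbit rotation u0))) //=.
apply: eq_bigr => u' u'_c.
rewrite sum1dep_card -(eqP (_ : porbit rotation u == porbit rotation u0)) ?eq_porbit_mem // in u'_c *.
case/porbitP: u'_c => i ->; rewrite -(card_rword_rotation u i); apply: eq_card => p.
rewrite !inE; case: eqP => [->|_]; rewrite ?andbF ?andbT //.
by rewrite mem_porbit.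
Qed.

Lemma card_neck c : c \in porbits rotation -> (0 < #|c|)%N.
Proof. by case/imsetP=> u _ ->; apply: porbit_gt0. Qed.

Lemma neck_multE c u : c \in porbits rotation -> u \in c -> neck_mult c = #|[set p | rword p == u]|.
Proof. by move=> c_rho u_c; rewrite /neck_mult (card_rword_in c_rho u_c) mulKn ?card_neck. Qed.

Lemma card_neckP c : c \in porbits rotation -> #|[set p | rword p \in c]| = (#|c| * neck_mult c)%N.
Proof.
move=> c_rho; have /card_gt0P[u u_c] := card_neck c_rho.
by rewrite (neck_multE c_rho u_c) (card_rword_in c_rho u_c).
Qed.

Definition cycles_over (c : {set pword q L}) := [set o in porbits s | rword @: o == c].

Lemma cycles_overP c o : reflect (exists2 p, o = porbit s p & neck p = c) (o \in cycles_over c).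
Proof.
have img p : rword @: porbit s p = neck p.
  by apply: porbit_morph => p'; rewrite (rotation_rword _ _ order_L).
rewrite inE; apply: (iffP andP) => [[/imsetP[p _ ->]]|[p -> <-]].
  by rewrite img => /eqP; exists p.
by rewrite img mem_porbits.
Qed.

Lemma cycles_over_partition c : c \in porbits rotation ->
  partition (cycles_over c) [set p | rword p \in c].
Proof.
case/imsetP=> u _ def_c; have /and3P[_ tI n0] := porbits_partition s.
have sub : cycles_over c \subset porbits s by apply/subsetP=> o; rewrite inE => /andP[].
apply/and3P; split; last by apply: contra n0; apply/subsetP.
  apply/eqP/setP=> p; rewrite inE def_c -eq_porbit_mem; apply/bigcupP/eqP => [[o]|p_c].
    case/cycles_overP=> p' -> nc p_p'; rewrite -nc.
    have /porbitP[i ->] := p_p'.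
    by rewrite -(rotationX_rword _ _ order_L) porbit_perm.
  exists (porbit s p); last exact: porbit_id.
  by apply/cycles_overP; exists p; rewrite // def_c.
exact: trivIsetS tI.
Qed.

(** A turn around an odd necklace reverses the [M] positions with a given reading:
    at most one of them is fixed, and belongs to a cycle of length [l], while the
    others are exchanged in pairs, in cycles of length [2 l]. *)
Lemma prod_cycles_over (A : comNzRingType) (z : nat -> A) c : c \in porbits rotation ->
  \prod_(o in cycles_over c) z #|o| = neck_cycles z (odd_neck neg c) #|c| (neck_mult c).
Proof.
move=> c_rho; have c_part := cycles_over_partition c_rho; have c_gt0 := card_neck c_rho.
rewrite /neck_cycles; case: ifPn => [odd_c | even_c]; last first.
  have size_o o : o \in cycles_over c -> #|o| = #|c|.
    by case/cycles_overP=> p -> def_c; rewrite cycle_size_even def_c.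
  rewrite (eq_bigr (fun=> z #|c|)) => [|o /size_o -> //]; rewrite prodr_const.
  have := card_uniform_partition size_o c_part; rewrite card_neckP // mulnC.
  by move/eqP; rewrite eqn_pmul2r // => /eqP ->.
have size_o o : o \in cycles_over c -> #|o| != #|c| -> #|o| = (2 * #|c|)%N.
  case/cycles_overP=> p -> def_c; rewrite -def_c => /negPf neq.
  by have := @cycle_size_odd p; rewrite def_c odd_c -def_c neq => /(_ isT)/eqP.
rewrite (bigID (fun o : {set 'I_n} => #|o| == #|c|)) /=.
rewrite (eq_bigr (fun=> z #|c|)) => [|o /andP[_ /eqP -> //]].
rewrite [X in _ * X](eq_bigr (fun=> z (2 * #|c|)%N)) => [|o /andP[o_c neq]]; last first.
  by rewrite size_o.
set O1 := [set o in cycles_over c | #|o| == #|c|].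
set O2 := [set o in cycles_over c | #|o| != #|c|].
rewrite (eq_bigl (mem O1)) => [|o]; last by rewrite !inE.
rewrite [X in _ * X](eq_bigl (mem O2)) => [|o]; last by rewrite !inE.
have parity a : neck a = c -> odd (\sum_(i < #|c|) neg (reading a i)).
  by move=> def_c; move: odd_c; rewrite -def_c odd_neckE.
rewrite !prodr_const; have O1_le1 : (#|O1| <= 1)%N.
  apply/card_le1_eqP=> o o'; rewrite ![_ \in O1]inE.
  move=> /andP[/cycles_overP[p -> neck_p] /eqP size_p].
  move=> /andP[/cycles_overP[p' -> neck_p'] /eqP size_p'].
  have : rword p' \in neck p by rewrite neck_p -neck_p' porbit_id.
  case/porbitP=> i; rewrite (rotationX_rword _ _ order_L) -(porbit_perm s i p).
  set r := (s ^+ i)%g p => eq_r.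
  have fix_r : (s ^+ #|c|)%g r = r by rewrite -size_p -(porbit_perm s i p) porbit_size_fix.
  have fix_p' : (s ^+ #|c|)%g p' = p' by rewrite -size_p' porbit_size_fix.
  have neck_r : neck r = c by rewrite /neck -eq_r.
  have [lt_r|lt_r|/val_inj -> //] := ltngtP r p'.
    have := reading_mono #|c| lt_r (esym eq_r).
    by rewrite parity // fix_r fix_p' ltnNge ltnW.
  have := reading_mono #|c| lt_r eq_r.
  by rewrite parity // fix_r fix_p' ltnNge ltnW.
have def_M : neck_mult c = (#|O1| + 2 * #|O2|)%N.
  have := card_partition c_part; rewrite card_neckP //.
  rewrite (bigID (fun o : {set 'I_n} => #|o| == #|c|)) /=.
  rewrite (eq_bigl (mem O1)) => [|o]; last by rewrite !inE.
  rewrite [X in (_ + X)%N](eq_bigl (mem O2)) => [|o]; last by rewrite !inE.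
  have size1 o : o \in O1 -> #|o| = #|c| by rewrite [_ \in O1]inE => /andP[_ /eqP].
  have size2 o : o \in O2 -> #|o| = (2 * #|c|)%N.
    by rewrite [_ \in O2]inE => /andP[o_c /(size_o _ o_c)].
  rewrite (eq_bigr _ size1) [X in (_ + X)%N](eq_bigr _ size2).
  rewrite !sum_nat_const => eq_M; apply/eqP; rewrite -(eqn_pmul2l c_gt0) eq_M; apply/eqP; ring.
rewrite def_M; case: #|O1| O1_le1 => [|[|//]] _.
  by rewrite add0n [(2 * #|O2|)%N]mul2n odd_double doubleK.
by rewrite [(2 * #|O2|)%N]mul2n oddD odd_double add1n /= uphalf_double.
Qed.

(** The weight of a word depends only on its multiset of necklaces, and is
    multiplicative in it. *)
Lemma weight_readings (A : comNzRingType) (wt : 'I_q -> A) (z : nat -> A) :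
  (\prod_p wt (v p)) * cycle_weight z s = \prod_(c in porbits rotation)
    ((\prod_(u in c) wt (u ord0)) ^+ neck_mult c * neck_cycles z (odd_neck neg c) #|c| (neck_mult c)).
Proof.
rewrite big_split /=; congr (_ * _); last first.
  rewrite cycle_weight_porbits (partition_big (fun o : {set 'I_n} => rword @: o) (mem (porbits rotation))) /=.
    apply: eq_bigr => c c_rho; rewrite -prod_cycles_over //.
    by apply: eq_bigl => o; rewrite inE.
  move=> o o_s; have /cycles_overP[p _ <-] : o \in cycles_over (rword @: o).
    by rewrite inE o_s eqxx.
  exact: mem_porbits.
rewrite (reindex_inj (@perm_inj _ s)) /=.
rewrite (eq_bigr (fun p => wt (rword p ord0))) => [|p _]; last first.
  by rewrite ffunE /reading expg1.
rewrite (partition_big rword xpredT) //=.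
rewrite (partition_big (porbit rotation) (mem (porbits rotation))) /=; last first.
  by move=> u _; apply: mem_porbits.
apply: eq_bigr => c c_rho; rewrite -prodrXl.
have /imsetP[u0 _ def_c] := c_rho.
apply: eq_big => u; first by rewrite def_c eq_porbit_mem.
move=> u_c; have {}u_c : u \in c by rewrite def_c -eq_porbit_mem -def_c.
rewrite (neck_multE c_rho u_c) -prodr_const; apply: eq_big => p; first by rewrite inE.
by move/eqP->.
Qed.

End CycleType.

(** * Multisets of necklaces *)

Lemma coefs_prod_multiset (A : comNzRingType) (I : finType) (P : pred I)
    (l : I -> nat) (a : I -> nat -> A) n : (forall i, P i -> (0 < l i)%N) ->
  coefs (\prod_(i | P i) \fps_ j (if (l i %| j)%N then a i (j %/ l i)%N else 0)) n
  = \sum_(m in [set m : {ffun I -> 'I_n.+1} | (m \in pfamily ord0 P (fun=> predT))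
                && (\sum_(i | P i) l i * m i == n)%N])
      \prod_(i | P i) a i (m i).
Proof.
move=> l_gt0.
have trunc : eqmodX n (\prod_(i | P i) \fps_ j (if (l i %| j)%N then a i (j %/ l i)%N else 0))
    (\prod_(i | P i) \sum_(M < n.+1) fpsC (a i M) * fpsX ^+ (l i * M)).
  apply: eqmodX_prod => i Pi j le_jn; rewrite coefs_sum.
  under [RHS]eq_bigr => M _ do rewrite coefsCM coefsXn.
  rewrite [LHS]/=.
  case: ifPn => [/dvdnP[M def_j]|l'j].
    have lt_M : (M < n.+1)%N by rewrite ltnS (leq_trans _ le_jn) // def_j leq_pmulr ?l_gt0.
    rewrite (bigD1 (Ordinal lt_M)) //= {1 2}def_j mulnK ?l_gt0 // mulnC eqxx mulr1.
    rewrite big1 ?addr0 // => M' neq_M; rewrite def_j mulnC eqn_pmul2l ?l_gt0 //.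
    by rewrite -val_eqE /= in neq_M; rewrite eq_sym (negPf neq_M) mulr0.
  rewrite big1 // => M _; case: eqP l'j => [->|]; rewrite ?mulr0 //.
  by rewrite dvdn_mulr.
rewrite trunc // (big_distr_big ord0) coefs_sum.
rewrite [RHS](eq_bigl (fun m : {ffun I -> 'I_n.+1} => (m \in pfamily ord0 P (fun=> predT))
  && (\sum_(i | P i) l i * m i == n)%N)); last by move=> m; rewrite inE.
rewrite [RHS]big_mkcondr /=; apply: eq_bigr => m _.
have -> : \prod_(i | P i) (fpsC (a i (m i)) * fpsX ^+ (l i * m i))
    = fpsC (\prod_(i | P i) a i (m i)) * fpsX ^+ (\sum_(i | P i) l i * m i).
  by rewrite big_split /= -rmorph_prod -expr_sum.
rewrite coefsCM coefsXn eq_sym.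
by case: eqP; rewrite ?mulr1 ?mulr0.
Qed.

Lemma sum_divisors_fibers (A : nmodType) (T : finType) (per : T -> nat) (P : pred T)
    (G : T -> nat -> A) i : (0 < i)%N ->
  \sum_(e <- divisors i) \sum_(u | (per u == e) && P u) G u e
  = \sum_(u | (per u %| i)%N && P u) G u (per u).
Proof.
move=> i_gt0; rewrite (exchange_big_dep P) /=; last by move=> e u _ /andP[].
rewrite [RHS]big_mkcondl; apply: eq_bigr => u Pu; rewrite Pu.
under eq_bigl => e do rewrite andbT.
case: ifPn => [per_i|per'i].
  rewrite big_mkcond (bigD1_seq (per u)) ?divisors_uniq -?dvdn_divisors //= eqxx.
  by rewrite big1 ?addr0 // => e; rewrite eq_sym => /negPf->.
rewrite big_seq_cond big1 // => e; rewrite -dvdn_divisors // => /andP[e_i /eqP per_e].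
by rewrite per_e e_i in per'i.
Qed.

Section Necklaces.
Variables (A : comNzRingType) (q : nat) (neg : pred 'I_q) (L : nat).
Variables (wt : 'I_q -> A) (z : nat -> A).
Local Notation rotation := (rotation q L).
Local Notation necks := (porbits rotation).
Local Notation odd_neck := (@odd_neck q neg L).
Implicit Types (c : {set pword q L}) (u : pword q L).

Definition wt_neck c := \prod_(u in c) wt (u ord0).

Definition neck_term c M := wt_neck c ^+ M * neck_cycles z (odd_neck c) #|c| M.

Definition neck_series c : {fps A} :=
  \fps_ j (if (#|c| %| j)%N then neck_term c (j %/ #|c|)%N else 0).

(** The default value outside the necklaces makes the representation of a multiset
    unique. *)
Definition multisets n := [set m : {ffun {set pword q L} -> 'I_n.+1} |
  (m \in pfamily ord0 (mem necks) (fun=> predT)) && (\sum_(c in necks) #|c| * m c == n)%N].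

Definition all_necks : {fps A} := \prod_(c in necks) neck_series c.

Lemma coefs_all_necks n :
  coefs all_necks n = \sum_(m in multisets n) \prod_(c in necks) neck_term c (m c).
Proof.
rewrite /all_necks (coefs_prod_multiset neck_term) //.
exact: card_neck.
Qed.

Definition neck_logd c : {fps A} :=
  let w := wt_neck c in let l := #|c| in
  if odd_neck c then - l%:R * (geo (- (z l * w)) l - 1)
                     + (2 * l)%:R * (geo (z (2 * l)%N * w ^+ 2) (2 * l) - 1)
  else l%:R * (geo (z l * w) l - 1).

(** Writing a multiplicity as [M = M %% 2 + 2 (M %/ 2)] factors the series of an
    odd necklace. *)
Lemma neck_seriesE c : c \in necks ->
  let w := wt_neck c in let l := #|c| in
  neck_series c = if odd_neck c
    then (1 - fpsC (- (z l * w)) * fpsX ^+ l) * geo (z (2 * l)%N * w ^+ 2) (2 * l)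
    else geo (z l * w) l.
Proof.
move=> /card_neck c_gt0 w l; apply: fpsP => n.
rewrite /neck_series /neck_term /neck_cycles -/l -/w.
case: ifP => _; last by rewrite /=; case: ifP => // _; rewrite exprMn mulrC.
rewrite rmorphN mulNr opprK mulrDl mul1r -mulrA coefsD coefsCM coefsXnM /=.
have [/dvdnP[M ->]|l'n] := boolP (l %| n)%N; last first.
  have l2 k : (2 * l %| k)%N -> (l %| k)%N by apply: dvdn_trans; rewrite dvdn_mull.
  case: ifP => [/l2|_]; first by rewrite (negPf l'n).
  case: leqP => [le_ln|_]; last by rewrite mulr0 addr0.
  case: ifP => [/l2|_]; last by rewrite mulr0 addr0.
  by rewrite -(dvdn_addl _ (dvdnn l)) subnK // (negPf l'n).
rewrite mulnK // dvdn_pmul2r // divnMr // dvdn2 divn2.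
case: M => [|M]; first by rewrite mul0n leqNgt c_gt0 /= !expr0 !mul1r mulr0 addr0.
rewrite [(M.+1 * l)%N]mulSn leq_addr addKn dvdn_pmul2r // divnMr // dvdn2 divn2.
rewrite -{1}(odd_double_half M.+1) /=; case: (boolP (odd M)) => odd_M /=.
  rewrite add0n exprMn -[(uphalf M).*2]mul2n exprM.
  by move: (w ^+ 2) => w2; ring.
rewrite uphalf_half (negPf odd_M) add0n exprMn exprD -[(M./2).*2]mul2n exprM.
by move: (w ^+ 2) => w2; ring.
Qed.

Lemma neck_series_logd c : c \in necks -> logd (neck_series c) (neck_logd c).
Proof.
move=> c_necks; have c_gt0 := card_neck c_necks.
rewrite neck_seriesE // /neck_logd; case: ifP => _; last exact: logd_geo.
apply: logd_mul; first exact: logd_geo_den.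
by apply: logd_geo; rewrite muln_gt0.
Qed.

Definition period u := #|porbit rotation u|.
Definition wt_word u := wt_neck (porbit rotation u).
Definition odd_word u := odd_neck (porbit rotation u).

(** An odd necklace of length [i / 2] also produces cycles of length [i], and thus
    contributes to the index [i] as well. The exponent [m.+1] has the parity of
    [m - 1]. *)
Definition period_sum i m : A :=
  \sum_(u | (period u == i) && true) (-1) ^+ (odd_word u * m.+1) * wt_word u ^+ m
  + \sum_(u | (2 * period u == i)%N && odd_word u) 2 * wt_word u ^+ (2 * m).

(** The factor [l] in the logarithmic derivative for a necklace of length [l]
    turns the sum over necklaces into a sum over words. *)
Lemma coefs_sum_neck_logd N : (0 < N)%N ->
  coefs (\sum_(c in necks) neck_logd c) N
  = \sum_(i <- divisors N) z i ^+ (N %/ i) * period_sum i (N %/ i).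
Proof.
move=> N_gt0; rewrite coefs_sum.
pose Q c : A := (if (#|c| %| N)%N then
     z #|c| ^+ (N %/ #|c|) * ((-1) ^+ (odd_neck c * (N %/ #|c|).+1) * wt_neck c ^+ (N %/ #|c|)) else 0)
  + (if (2 * #|c| %| N)%N && odd_neck c then
      z (2 * #|c|)%N ^+ (N %/ (2 * #|c|)) * (2 * wt_neck c ^+ (2 * (N %/ (2 * #|c|)))) else 0).
have neckQ c : c \in necks -> coefs (neck_logd c) N = #|c|%:R * Q c.
  move=> c_necks; rewrite /neck_logd /Q.
  have coef_geo (a : A) l : coefs (l%:R * (geo a l - 1)) N
      = l%:R * (if (l %| N)%N then a ^+ (N %/ l) else 0).
    by rewrite coefs_natM coefsD coefsN coefs1 /= (gtn_eqF N_gt0) subr0.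
  case: (odd_neck c); rewrite ?andbT ?andbF ?addr0 ?mul0n ?mul1n.
    rewrite mulNr coefsD coefsN !coef_geo mulrDr natrM; congr (_ + _).
      rewrite -mulrN; congr (_ * _); case: ifP => _; rewrite ?oppr0 //.
      by rewrite (exprNn (z #|c| * _)) exprMn exprS mulN1r mulNr mulrN mulrCA.
    rewrite -mulrA mulrCA; congr (_ * _); case: ifP => _; rewrite ?mulr0 //.
    by rewrite exprMn exprM mulrCA.
  by rewrite coef_geo; case: ifP => _; rewrite ?expr0 ?mul1r ?exprMn.
rewrite (eq_bigr _ neckQ).
have -> : \sum_(c in necks) #|c|%:R * Q c = \sum_u Q (porbit rotation u).
  rewrite [RHS](partition_big (porbit rotation) (mem necks)) /=; last first.
    by move=> u _; apply: mem_porbits.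
  apply: eq_bigr => c /imsetP[u0 _ ->]; rewrite mulr_natl -sumr_const.
  by apply: eq_big => u; rewrite -eq_porbit_mem // => /eqP->.
rewrite big_split /= -!big_mkcond /=.
rewrite -[X in X + _](eq_bigl _ _ (fun u => andbT _)).
rewrite -(sum_divisors_fibers _ _ (fun u i => z i ^+ (N %/ i) *
   ((-1) ^+ (odd_word u * (N %/ i).+1) * wt_word u ^+ (N %/ i)))) //.
rewrite -(sum_divisors_fibers (fun u => 2 * period u)%N odd_word (fun u i => z i ^+ (N %/ i) *
   (2 * wt_word u ^+ (2 * (N %/ i))))) // -big_split /=.
by apply: eq_bigr => i _; rewrite /period_sum mulrDr !mulr_sumr.
Qed.

End Necklaces.

(** * Power sums and primitive words *)

Lemma prod_iter_porbit (A : comNzRingType) (T : finType) (s : {perm T}) (F : T -> A) x k :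
  \prod_(j < k * #|porbit s x|) F ((s ^+ j)%g x) = (\prod_(y in porbit s x) F y) ^+ k.
Proof.
elim: k => [|k IHk]; first by rewrite mul0n big_ord0.
rewrite mulSn big_split_ord exprS /= -IHk big_porbit; congr (_ * _).
by apply: eq_bigr => j _; rewrite expgD permM porbit_size_fix.
Qed.

Section PowerSums.
Variables (A : comNzRingType) (q : nat) (neg : pred 'I_q) (L : nat) (wt : 'I_q -> A).
Local Notation rotation := (rotation q L).
Local Notation period := (@period q L).

(** The power sum of a signed alphabet, in the sense of supersymmetric functions:
    a negative letter of weight [a] contributes [(-1) ^ (m - 1) a ^ m]. *)
Definition power_sum m : A := \sum_a (-1) ^+ (neg a * m.+1) * wt a ^+ m.

Definition extend i (x : {ffun 'I_i.+1 -> 'I_q}) : pword q L :=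
  [ffun j : 'I_L.+1 => x (inord (j %% i.+1))].

(** The words of length [i.+1] correspond to the periodic words that [i.+1]
    rotations fix. *)
Lemma sum_periodic (F : 'I_q -> A) i : (i.+1 %| L.+1)%N ->
  (\sum_a F a) ^+ i.+1
  = \sum_(u | (period u %| i.+1)%N) \prod_(j < i.+1) F ((rotation ^+ j)%g u ord0).
Proof.
move=> iL; have le_iL : (i < L.+1)%N by apply: dvdn_leq.
have ltm j : (j %% i.+1 < i.+1)%N by rewrite ltn_mod.
have fixE u : (period u %| i.+1)%N = ((rotation ^+ i.+1)%g u == u) by rewrite porbit_dvdP.
rewrite -[X in _ ^+ X]card_ord -prodr_const bigA_distr_bigA.
rewrite (reindex_onto (@extend i) (fun u => [ffun j : 'I_i.+1 => u (inord j)])) /=.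
  apply: eq_big => x.
    rewrite fixE; apply/esym/andP; split; apply/eqP/ffunP=> j.
      rewrite rotationXE !ffunE inordK ?ltn_mod //; congr (x (inord _)).
      by rewrite modn_dvdm // modnDr.
    rewrite !ffunE inordK ?(leq_trans (ltn_ord j)) // modn_small ?inord_val //.
  move=> _; apply: eq_bigr => j _; rewrite rotationXE ffunE add0n.
  have lt_jL : (j < L.+1)%N := leq_trans (ltn_ord j) le_iL.
  by rewrite modn_small // inordK // modn_small // inord_val.
move=> u per_u; apply/ffunP=> j; rewrite !ffunE inordK //.
have fix_u : (rotation ^+ (i.+1 * (j %/ i.+1)))%g u = u.
  by apply/eqP; rewrite porbit_dvdP dvdn_mulr.
have lt_m : (j %% i.+1 < L.+1)%N := leq_trans (ltm j) le_iL.
rewrite -{1}fix_u rotationXE inordK //; congr (u _); apply: val_inj.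
by rewrite /= addnC mulnC -divn_eq modn_small ?inordK.
Qed.

(** Every word is a power of a primitive one. For an even power of an odd word
    the sign on the left is [1], while the first half of [period_sum] gives [-1];
    the second half makes up the difference of [2]. *)
Lemma power_sum_exp i m : (0 < i)%N -> (i %| L.+1)%N ->
  power_sum m ^+ i = \sum_(e <- divisors i) period_sum neg L wt e (m * (i %/ e)).
Proof.
case: i => // i _ iL; rewrite sum_periodic // big_split /=.
rewrite (sum_divisors_fibers _ _ (fun u e => (-1) ^+ (odd_word neg u * (m * (i.+1 %/ e)).+1)
           * wt_word wt u ^+ (m * (i.+1 %/ e)))) //.
rewrite (sum_divisors_fibers (fun u => 2 * period u)%N (@odd_word q neg L)
          (fun u e => 2 * wt_word wt u ^+ (2 * (m * (i.+1 %/ e))))) //.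
have dvd_per u : (2 * period u %| i.+1)%N -> (period u %| i.+1)%N.
  by apply: dvdn_trans; rewrite dvdn_mull.
rewrite [X in _ = _ + X](eq_bigl (fun u => (period u %| i.+1)%N
   && ((2 * period u %| i.+1)%N && odd_word neg u))); last first.
  by move=> u; case: (boolP (2 * _ %| _)%N) => [/dvd_per ->|_]; rewrite ?andbF.
rewrite [X in _ = _ + X]big_mkcondr.
rewrite [X in _ = X + _](eq_bigl (fun u => period u %| i.+1)%N); last by move=> u; rewrite andbT.
rewrite -big_split /=; apply: eq_bigr => u per_u.
have per_gt0 : (0 < period u)%N := porbit_gt0 rotation u.
rewrite -(big_mkord xpredT (fun j => (-1) ^+ (neg ((rotation ^+ j)%g u ord0) * m.+1)
                                     * wt ((rotation ^+ j)%g u ord0) ^+ m)).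
have [d def_i] := dvdnP per_u; rewrite def_i big_mkord.
rewrite (prod_iter_porbit rotation (fun y => (-1) ^+ (neg (y ord0) * m.+1) * wt (y ord0) ^+ m)).
rewrite mulnK // dvdn_pmul2r // dvdn2 divnMr // divn2 big_split /=.
rewrite prodrXl -/(wt_neck wt _) -/(wt_word wt u).
have -> : \prod_(y in porbit rotation u) (-1) ^+ (neg (y ord0) * m.+1)
    = (-1) ^+ (odd_word neg u * m.+1) :> A.
  rewrite exprM signr_odd -exprM -sum1dep_card big_mkcondr /= exprM -expr_sum -exprM.
  rewrite big_distrl /= expr_sum; apply: eq_bigr => y _.
  by case: (neg _).
rewrite exprMn -!exprM; case: (odd_word neg u); last first.
  by rewrite andbF addr0 !mul0n !expr0 mul1r.
rewrite andbT !mul1n -(signr_odd _ (m.+1 * d)) -(signr_odd _ (m * d).+1).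
rewrite oddM [odd (m * d).+1]/= oddM /=.
have [odd_d|even_d] := boolP (odd d); first by rewrite !andbT addr0.
rewrite !andbF expr0 expr1 -{1 2}(even_halfK even_d) -!mul2n mulnCA.
by move: (_ ^+ (2 * _)) => w /=; ring.
Qed.

Lemma period_sumE i m : (0 < i)%N -> (0 < m)%N -> (i %| L.+1)%N ->
  period_sum neg L wt i m
  = \sum_(d <- divisors i) (moebius d)%:~R * power_sum (d * m) ^+ (i %/ d).
Proof.
move=> i_gt0 m_gt0 iL; symmetry.
apply: (moebius_inversion (P := fun j l => power_sum l ^+ j)) => // j l l_gt0 j_i.
by rewrite power_sum_exp ?(dvdn_gt0 i_gt0) // (dvdn_trans j_i).
Qed.

End PowerSums.

(** * The signed Gessel-Reutenauer recurrence *)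

Section Recurrence.
Variables (A : comNzRingType) (q : nat) (neg : pred 'I_q) (L : nat).
Variables (wt : 'I_q -> A) (z : nat -> A).

Lemma all_necks_rec n :
  n%:R * coefs (all_necks neg L wt z) n
  = \sum_(1 <= N < n.+1) (\sum_(i <- divisors N) z i ^+ (N %/ i) * period_sum neg L wt i (N %/ i))
      * coefs (all_necks neg L wt z) (n - N).
Proof.
have all_logd : logd (all_necks neg L wt z)
    (\sum_(c in porbits (rotation q L)) neck_logd neg wt z c).
  by apply: logd_prod => c; apply: neck_series_logd.
rewrite (coefs_logd n all_logd).
rewrite big_ord_recl coefs_sum big1 ?mul0r ?add0r => [|c _]; last first.
  have geo0 (a : A) l : coefs (geo a l - 1) 0 = 0.
    by rewrite coefsD coefsN coefs1 /= dvdn0 div0n expr0 subrr.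
  rewrite /neck_logd; case: ifP => _; last by rewrite coefs_natM geo0 mulr0.
  by rewrite mulNr coefsD coefsN !coefs_natM !geo0 !mulr0 oppr0 addr0.
rewrite big_add1 /= big_mkord; apply: eq_bigr => N _.
by rewrite coefs_sum_neck_logd.
Qed.

Lemma all_necks0 : coefs (all_necks neg L wt z) 0 = 1.
Proof.
have -> : coefs (all_necks neg L wt z) 0 = coefs (\prod_(c in porbits (rotation q L)) (1 : {fps A})) 0.
  apply: (@eqmodX_prod _ 0) => // c _ j; rewrite leqn0 => /eqP->.
  rewrite coefs1 /= dvdn0 div0n /neck_term /neck_cycles !expr0 mul1r.
  by case: ifP; rewrite ?mulr1.
by rewrite big1_eq coefs1.
Qed.

End Recurrence.

(** With all weights equal to [1] the recurrence reads
    [n c_n = q c_(n-1) + q^2 c_(n-2) + ... + q^n c_0], since [q ^ N] words have a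
    period dividing [N]; its solution is [c_n = q ^ n]. *)
Lemma card_multisets q L n :
  (forall N, (0 < N <= n)%N -> (N %| L.+1)%N) -> #|multisets q L n| = (q ^ n)%N.
Proof.
pose F := all_necks (A := int) (pred0 : pred 'I_q) L (fun=> 1) (fun=> 1).
have cardE k : coefs F k = #|multisets q L k|%:R.
  rewrite coefs_all_necks -sumr_const; apply: eq_bigr => m _.
  rewrite big1 // => c _; rewrite /neck_term /neck_cycles /wt_neck big1_eq !expr1n.
  by case: ifP; rewrite !mulr1.
elim/ltn_ind: n => n IHn nL; apply/eqP.
have [->|n_gt0] := posnP n; first by rewrite -(eqr_nat int) -cardE all_necks0.
rewrite -(eqr_nat int) -cardE.
have n_neq0 : n%:R != 0 :> int by rewrite pnatr_eq0 -lt0n.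
rewrite -(inj_eq (mulfI n_neq0)) all_necks_rec; apply/eqP.
rewrite big_nat (eq_bigr (fun=> (q ^ n)%:R)) => [|N /andP[N_gt0 le_Nn]].
  by rewrite -big_nat sumr_const_nat subn1 mulr_natl.
rewrite -/F cardE IHn; last 2 first.
- by rewrite -subn_gt0 subKn.
- by move=> k /andP[k_gt0 le_k]; apply: nL; rewrite k_gt0 (leq_trans le_k) ?leq_subr.
have -> : \sum_(i <- divisors N) 1 ^+ (N %/ i) * period_sum (pred0 : pred 'I_q) L (fun=> 1 : int) i (N %/ i)
    = (q ^ N)%:R :> int.
  have NL : (N %| L.+1)%N by rewrite nL // N_gt0.
  transitivity (\sum_(i <- divisors N)
      period_sum (pred0 : pred 'I_q) L (fun=> 1 : int) i (1 * (N %/ i))).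
    by apply: eq_bigr => i _; rewrite expr1n mul1r mul1n.
  rewrite -power_sum_exp // natrX; congr (_ ^+ _); rewrite /power_sum.
  rewrite (eq_bigr (fun=> 1)) => [|a _]; last by rewrite mul0n expr0 expr1n mul1r.
  by rewrite sumr_const card_ord.
by rewrite -natrM -expnD subnKC.
Qed.

Section Bijection.
Variables (q : nat) (neg : pred 'I_q) (L n : nat).
Implicit Types v : {ffun 'I_n -> 'I_q}.
Hypothesis order_L : (n`! %| L.+1)%N.
Local Notation necks := (porbits (rotation q L)).

Definition readings v : {ffun {set pword q L} -> 'I_n.+1} :=
  [ffun c => if c \in necks then inord (neck_mult neg v c) else ord0].

Lemma readingsE v c : c \in necks -> readings v c = neck_mult neg v c :> nat.
Proof.
move=> c_necks; rewrite ffunE c_necks inordK // ltnS /neck_mult.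
by rewrite (leq_trans (leq_div _ _)) // -[leqRHS]card_ord max_card.
Qed.

Lemma readings_multisets v : readings v \in multisets q L n.
Proof.
rewrite inE; apply/andP; split.
  apply/pfamilyP; split=> // ; apply/subsetP=> c; rewrite inE ffunE.
  by case: ifP => //; rewrite eqxx.
apply/eqP; transitivity (\sum_(c in necks) #|[set p | rword neg L v p \in c]|)%N.
  by apply: eq_bigr => c c_necks; rewrite readingsE // card_neckP.
rewrite -[RHS]card_ord -sum1_card.
rewrite (partition_big (fun p => porbit (rotation q L) (rword neg L v p)) (mem necks)) /=.
  apply: eq_bigr => _ /imsetP[u _ ->]; rewrite sum1dep_card.
  by apply: eq_card => p; rewrite !inE -eq_porbit_mem.
by move=> p _; apply: mem_porbits.
Qed.

Lemma readings_inj : injective readings.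
Proof.
move=> v v' eq_vv'; apply: (rword_inj (neg := neg) order_L) => u.
have u_c := porbit_id (rotation q L) u; have c_necks := mem_porbits (rotation q L) u.
have cardE x : #|[set p | rword neg L x p == u]| = readings x (porbit (rotation q L) u).
  by rewrite readingsE // (neck_multE _ _ order_L c_necks u_c).
by rewrite !cardE eq_vv'.
Qed.

(** Injectivity is enough, as there are equally many words and multisets. *)
Lemma readings_image : readings @: [set: {ffun 'I_n -> 'I_q}] = multisets q L n.
Proof.
apply/eqP; rewrite eqEcard; apply/andP; split.
  by apply/subsetP=> _ /imsetP[v _ ->]; apply: readings_multisets.
rewrite card_imset; last exact: readings_inj.
rewrite cardsT card_ffun !card_ord card_multisets // => N N_le.
exact: dvdn_trans (dvdn_fact N_le) order_L.
Qed.

End Bijection.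

Section GesselReutenauer.
Variables (A : comNzRingType) (q : nat) (neg : pred 'I_q).
Variables (wt : 'I_q -> A) (z : nat -> A).

Definition word_sum n : A :=
  \sum_(v : {ffun 'I_n -> 'I_q}) (\prod_p wt (v p)) * cycle_weight z (st neg v).

Definition primitive_sum i m : A :=
  \sum_(d <- divisors i) (moebius d)%:~R * power_sum neg wt (d * m) ^+ (i %/ d).

Lemma word_sum_necks L n : (n`! %| L.+1)%N ->
  word_sum n = coefs (all_necks neg L wt z) n.
Proof.
move=> nL; rewrite coefs_all_necks -(readings_image neg nL) big_imset /=; last first.
  by move=> v v' _ _; apply: readings_inj.
rewrite (eq_bigl xpredT) => [|v]; last by rewrite inE.
apply: eq_bigr => v _; rewrite (weight_readings _ v nL); apply: eq_bigr => c c_necks.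
by rewrite /neck_term readingsE.
Qed.

Lemma dvdn_factorial k n : (k <= n)%N -> (k`! %| n`!)%N.
Proof. by move=> le_kn; rewrite -(bin_fact le_kn) mulnCA dvdn_mulr. Qed.

(** In terms of generating functions, the words are enumerated by the product over
    [i] of [exp (\sum_m z_i^m X^(i m) primitive_sum i m / (i m))]. *)
Theorem word_sum_rec n :
  n%:R * word_sum n = \sum_(1 <= N < n.+1)
    (\sum_(i <- divisors N) z i ^+ (N %/ i) * primitive_sum i (N %/ i)) * word_sum (n - N).
Proof.
(* All cycle lengths up to [n] divide [n`!], which serves as a common period. *)
have [L def_L] : exists L, n`! = L.+1 by exists n`!.-1; rewrite prednK ?fact_gt0.
rewrite (@word_sum_necks L) -?def_L // all_necks_rec big_nat [RHS]big_nat.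
apply: eq_bigr => N /andP[N_gt0 le_Nn].
rewrite (@word_sum_necks L) -?def_L ?dvdn_factorial ?leq_subr //; congr (_ * _).
rewrite big_seq [RHS]big_seq; apply: eq_bigr => i; rewrite -dvdn_divisors // => i_N.
have i_gt0 := dvdn_gt0 N_gt0 i_N; congr (_ * _); apply: period_sumE => //.
  by rewrite divn_gt0 // dvdn_leq.
by rewrite -def_L dvdn_fact // i_gt0 (leq_trans (dvdn_leq N_gt0 i_N)).
Qed.

Lemma word_sum0 : word_sum 0 = 1.
Proof. by rewrite (@word_sum_necks 0) // all_necks0. Qed.

End GesselReutenauer.

(** * Words with a given standardization *)

Section Chains.
Variables (A : comNzRingType) (q : nat) (neg : nat -> bool) (wt : nat -> A) (d : nat -> bool).

(** The boolean [b] tells whether the two letters stand at a descent. *)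
Definition may_follow (b : bool) (a a' : nat) := (a < a')%N || (a == a') && (b == neg a').

Definition chain m (w : {ffun 'I_m.+1 -> 'I_q}) :=
  [forall i : 'I_m, may_follow (d i) (w (inord i)) (w (inord i.+1))].

(** The transfer recursion for the sum computed in [sum_chain_end]. *)
Fixpoint chain_end m a : A :=
  wt a * (if m is m'.+1 then
    \sum_(b < a) chain_end m' b + (if d m' == neg a then chain_end m' a else 0) else 1).

Definition append m (p : {ffun 'I_m.+1 -> 'I_q} * 'I_q) : {ffun 'I_m.+2 -> 'I_q} :=
  [ffun i => if unlift ord_max i is Some j then p.1 j else p.2].

Lemma append_inord m p (i : nat) : (i < m.+1)%N ->
  @append m p (inord i) = p.1 (inord i).
Proof.
move=> lt_i; rewrite ffunE.
have -> : inord i = lift ord_max (inord i : 'I_m.+1) :> 'I_m.+2.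
  apply: val_inj; rewrite /= inordK ?(ltn_trans lt_i) // inordK // /bump leqNgt lt_i.
  by rewrite add0n.
by rewrite liftK.
Qed.

Lemma append_max m p : @append m p ord_max = p.2.
Proof. by rewrite ffunE unlift_none. Qed.

Lemma append_bij m : bijective (@append m).
Proof.
exists (fun w : {ffun 'I_m.+2 -> 'I_q} => ([ffun j => w (lift ord_max j)], w ord_max)).
  move=> [w a] /=; rewrite append_max; congr (_, _).
  by apply/ffunP=> j; rewrite !ffunE liftK.
move=> w; apply/ffunP=> i; rewrite ffunE.
by case: unliftP => [j ->|->] //=; rewrite ffunE.
Qed.

Lemma sum_chain_end m (a : 'I_q) :
  \sum_(w | @chain m w && (w ord_max == a)) \prod_i wt (w i) = chain_end m a.
Proof.
elim: m a => [|m IHm] a.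
  rewrite (big_pred1 [ffun=> a]) => [|w]; first by rewrite big_ord1 ffunE /= mulr1.
  have -> : chain w by apply/forallP=> -[].
  apply/eqP/eqP=> [<-|->]; last by rewrite ffunE.
  by apply/ffunP=> i; rewrite ffunE; congr (w _); apply: val_inj; case: i => -[].
rewrite (reindex (@append m)) /=; last by apply: onW_bij; apply: append_bij.
transitivity (\sum_(w | @chain m w && may_follow (d m) (w ord_max) a) wt a * \prod_i wt (w i)).
  rewrite [RHS](reindex_onto (@fst _ 'I_q) (fun w => (w, a))) //=.
  apply: eq_big => [[w b]|[w b] /=].
    rewrite /= append_max xpair_eqE eqxx /= [a == b]eq_sym; case: eqP => [->|_]; last by rewrite !andbF.
    rewrite !andbT; apply/forallP/andP => [ok_w|[/forallP ok_w ok_a] i].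
      split; first apply/forallP=> i.
        have := ok_w (widen_ord (leqnSn m) i).
        by rewrite /= !append_inord ?ltnS ?(ltnW (ltn_ord i)) ?ltn_ord.
      have := ok_w ord_max; rewrite /= append_inord // -[inord m.+1]/(inord (ord_max : 'I_m.+2)).
      by rewrite inord_val append_max (_ : inord m = ord_max) //; apply: val_inj; rewrite /= inordK.
    have [lt_im|ge_im] := ltnP i m.
      by rewrite !append_inord ?ltnS ?(ltnW lt_im) //; apply: ok_w (Ordinal lt_im).
    have -> : i = m :> nat by apply/eqP; rewrite eqn_leq ge_im -ltnS ltn_ord.
    rewrite append_inord // -[inord m.+1]/(inord (ord_max : 'I_m.+2)) inord_val append_max /=.
    by rewrite (_ : inord m = ord_max) //; apply: val_inj; rewrite /= inordK.
  rewrite append_max => /andP[_ /eqP /= ->]; rewrite big_ord_recr /= append_max mulrC.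
  congr (_ * _); apply: eq_bigr => i _; congr (wt _).
  by rewrite -[widen_ord _ _]inord_val append_inord //= inord_val.
rewrite -mulr_sumr; congr (_ * _).
rewrite (partition_big (fun w : {ffun 'I_m.+1 -> 'I_q} => w ord_max)
   (fun b : 'I_q => may_follow (d m) b a)) /=; last by move=> w /andP[].
transitivity (\sum_(b : 'I_q | may_follow (d m) b a) chain_end m b).
  apply: eq_bigr => b ok_b; rewrite -IHm; apply: eq_bigl => w.
  by case: eqP => [->|]; rewrite ?andbF // ok_b andbT.
rewrite (bigID (fun b : 'I_q => b < a)%N) /=; congr (_ + _).
  rewrite (big_ord_widen q) 1?ltnW //; apply: eq_bigl => b.
  by rewrite /may_follow; case: (b < a)%N; rewrite ?andbF.
case: ifP => [eq_d|neq_d]; last first.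
  rewrite big1 // => b; rewrite /may_follow; case: (b < a)%N; rewrite ?andbF //=.
  by rewrite neq_d andbF.
rewrite (big_pred1 a) // => b; rewrite /may_follow eq_d andbT /= -[RHS](inj_eq val_inj) /=.
by case: ltngtP.
Qed.

Lemma sum_chain m :
  \sum_(w | @chain m w) \prod_i wt (w i) = \sum_(a < q) chain_end m a.
Proof.
rewrite (partition_big (fun w : {ffun 'I_m.+1 -> 'I_q} => w ord_max) xpredT) //=.
by apply: eq_bigr => a _; rewrite sum_chain_end.
Qed.

End Chains.

(** * Generating functions by peaks and descents *)

Section Transfer.
Variables (R : comNzRingType) (y : R).
(** The alphabet of [k] negative and [k] positive letters is the interval below
    [k.*2], where the two kinds alternate, the least letter being negative. *)
Definition even_neg (a : nat) := ~~ odd a.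
Definition letter_weight (a : nat) : R := if odd a then 1 else y.
Implicit Types (W : nat -> R) (d : nat -> bool).

(** In [gf_pos] and [gf_neg] the exponent is the rank of the pair that contains the
    last letter; in [gf_total] it is the number of available pairs. *)
Definition gf_pos W : {fps R} := \fps_ j (if j is j'.+1 then W j'.*2.+1 else 0).
Definition gf_neg W : {fps R} := \fps_ j (if j is j'.+1 then W j'.*2 else 0).
Definition gf_total W : {fps R} := \fps_ j (\sum_(a < j.*2) W a).
Definition chain_step b W a := letter_weight a * (\sum_(c < a) W c + (if b == even_neg a then W a else 0)).

Lemma gf_totalE W : (1 - fpsX) * gf_total W = gf_pos W + gf_neg W.
Proof.
apply: fpsP => -[|j]; rewrite mulrBl mul1r !coefsD coefsN coefsXM /=.
  by rewrite big_ord0 subr0 addr0.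
by rewrite doubleS !big_ord_recr /=; ring.
Qed.

Lemma gf_pos_asc W : gf_pos (chain_step false W) = gf_total W.
Proof.
apply: fpsP => -[|j] /=; first by rewrite big_ord0.
by rewrite /chain_step /letter_weight /even_neg /= odd_double /= mul1r doubleS !big_ord_recr.
Qed.

Lemma gf_neg_asc W : gf_neg (chain_step false W) = fpsC y * fpsX * gf_total W.
Proof.
apply: fpsP => -[|j]; rewrite -mulrA coefsCM coefsXM /= ?mulr0 //.
by rewrite /chain_step /letter_weight /even_neg /= odd_double /= addr0.
Qed.

Lemma gf_pos_desc W : gf_pos (chain_step true W) = gf_total W - gf_pos W.
Proof.
apply: fpsP => -[|j]; rewrite coefsD coefsN /= ?big_ord0 ?subr0 //.
by rewrite /chain_step /letter_weight /even_neg /= odd_double /= mul1r doubleS !big_ord_recr /= addr0 addrK.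
Qed.

Lemma gf_neg_desc W : gf_neg (chain_step true W) = fpsC y * (gf_total W - gf_pos W).
Proof.
apply: fpsP => -[|j]; rewrite coefsCM coefsD coefsN /= ?big_ord0 ?subr0 ?mulr0 //.
by rewrite /chain_step /letter_weight /even_neg /= odd_double /= doubleS !big_ord_recr /= addrK.
Qed.

Local Notation X := (fpsX : {fps R}).
Local Notation yC := (fpsC y : {fps R}).

Definition ndes d m := (\sum_(i < m) d i)%N.
Definition npk d m := (\sum_(i < m) (if (i : nat) is i'.+1 then ~~ d i' && d i'.+1 else false : bool))%N.

Definition last_descent d m := if m is m'.+1 then d m' else true.

(** Each step multiplies the generating function by a factor that depends only on
    this step and on the preceding one: [1 + y] for an ascent after a descent,
    [X (1 + y)] for a descent after an ascent, [1 + y X] or [y + X] for a repeated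
    ascent or descent. A virtual descent precedes the word, so there is one more
    ascent after a descent than peaks if the word ends with an ascent. *)
Lemma chain_transfer d m :
  let last := last_descent d m in
  let W := chain_end even_neg letter_weight d m in
  exists a b, [/\ ndes d m = (npk d m + a)%N, m = (ndes d m + npk d m + b + ~~ last)%N,
    (1 - X) ^+ m.+1 * gf_pos W
      = X ^+ (npk d m).+1 * (1 + yC) ^+ (2 * npk d m + ~~ last)
        * (yC + X) ^+ a * (1 + yC * X) ^+ b
   & (1 - X) * gf_total W = (if last then 1 + yC else 1 + yC * X) * gf_pos W].
Proof.
elim: m => [|m [a [b]]] /=.
  exists 0%N, 0%N; rewrite /ndes /npk !big_ord0; split=> //.
    apply: fpsP => j; rewrite !expr1 !mulr1 mulrBl mul1r coefsD coefsN coefsXM.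
    by case: j => [|[|j]] /=; rewrite /letter_weight /= ?odd_double /= ?subr0 ?mulr1 ?subrr.
  rewrite gf_totalE mulrDl mul1r; congr (_ + _); apply: fpsP => j; rewrite coefsCM.
  by case: j => [|j] /=; rewrite /letter_weight /= ?odd_double /= ?mulr0 ?mulr1.
set W := chain_end _ _ _ m => -[des_a m_b posW allW].
pose W' := chain_end even_neg letter_weight d m.+1.
have posE : gf_pos W' = gf_pos (chain_step (d m) W) by [].
have negE : gf_neg W' = gf_neg (chain_step (d m) W) by [].
have desS : ndes d m.+1 = (ndes d m + d m)%N by rewrite /ndes big_ord_recr.
have pkS : npk d m.+1 = (npk d m + (~~ last_descent d m && d m))%N.
  by rewrite /npk big_ord_recr /=; case: (m).
have allW' : (1 - X) * gf_total W' = (if d m then 1 + yC else 1 + yC * X) * gf_pos W'.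
  rewrite gf_totalE posE negE; case: (d m).
    by rewrite gf_pos_desc gf_neg_desc; ring.
  by rewrite gf_pos_asc gf_neg_asc; ring.
have posW' : (1 - X) * gf_pos W' = gf_pos W *
    (if last_descent d m then if d m then yC + X else 1 + yC
     else if d m then X * (1 + yC) else 1 + yC * X).
  rewrite posE; move: allW; case: (d m); case: (last_descent d m) => allW;
    by rewrite ?gf_pos_desc ?gf_pos_asc ?mulrBr allW; ring.
have {}posW' : (1 - X) ^+ m.+2 * gf_pos W' = X ^+ (npk d m).+1
    * (1 + yC) ^+ (2 * npk d m + ~~ last_descent d m) * (yC + X) ^+ a * (1 + yC * X) ^+ b
    * (if last_descent d m then if d m then yC + X else 1 + yC
       else if d m then X * (1 + yC) else 1 + yC * X).
  by rewrite exprSr -mulrA posW' mulrA posW.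
rewrite -/W -/(chain_end even_neg letter_weight d m.+1) -/W' allW' posW' desS pkS.
move: des_a m_b; case: (last_descent d m); case: (d m) => /= des_a m_b.
- exists a.+1, b; split; rewrite ?addn0 //; try lia.
  by rewrite !exprS; ring.
- exists a, b; split; rewrite ?addn0 //; try lia.
  by rewrite addn1 !exprS; ring.
- exists a, b; split; rewrite ?addn0 //; try lia.
  by rewrite !addn1 mulnS exprD !exprS; ring.
- exists a, b.+1; split; rewrite ?addn0 //; try lia.
  by rewrite !exprS; ring.
Qed.

(** Summing over the last letter acts as a final ascent. *)
Lemma chain_gf d m : exists a b,
  [/\ ndes d m = (npk d m + a)%N, m = (ndes d m + npk d m + b)%N
    & (1 - X) ^+ m.+2 * gf_total (chain_end even_neg letter_weight d m)
      = X ^+ (npk d m).+1 * (1 + yC) ^+ (2 * npk d m).+1 * (yC + X) ^+ a * (1 + yC * X) ^+ b].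
Proof.
have [a [b []]] := chain_transfer d m; set W := chain_end _ _ _ _.
move=> des_a m_b posW allW.
have {}posW : (1 - X) ^+ m.+2 * gf_total W
  = X ^+ (npk d m).+1 * (1 + yC) ^+ (2 * npk d m + ~~ last_descent d m) * (yC + X) ^+ a
    * (1 + yC * X) ^+ b * (if last_descent d m then 1 + yC else 1 + yC * X).
  by rewrite exprSr -mulrA allW mulrCA posW mulrC.
rewrite posW; case: (last_descent d m) m_b => /= m_b.
  by exists a, b; split=> //; [lia | rewrite addn0 !exprS; ring].
by exists a, b.+1; split=> //; [lia | rewrite addn1 !exprS; ring].
Qed.

End Transfer.

Section Descents.
Variables (m : nat) (s : 'S_m.+1).

Definition descent (i : nat) : bool := (s (inord i.+1) < s (inord i))%N.

Lemma ascentE i : (i < m)%N -> (s (inord i) < s (inord i.+1))%N = ~~ descent i.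
Proof.
move=> lt_im; rewrite /descent -leqNgt ltn_neqAle val_eqE (inj_eq perm_inj).
by rewrite -val_eqE /= !inordK // ?ltnS ?(ltnW lt_im) // neq_ltn ltnSn.
Qed.

Lemma existsS (i : 'I_m.+1) (P : pred 'I_m.+1) :
  [exists j : 'I_m.+1, (j == i.+1 :> nat) && P j] = (i < m)%N && P (inord i.+1).
Proof.
apply/existsP/andP => [[j /andP[/eqP def_j Pj]]|[lt_im Pi]].
  rewrite -ltnS -def_j ltn_ord; split=> //.
  by rewrite inord_val.
by exists (inord i.+1); rewrite inordK ?ltnS // eqxx.
Qed.

Lemma des_ndes : des s = ndes descent m.
Proof.
have desE (i : 'I_m.+1) : [exists j : 'I_m.+1, (j == i.+1 :> nat) && (s j < s i)%N]
    = (i < m)%N && (s (inord i.+1) < s i)%N by exact: (existsS i (fun j => s j < s i)%N).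
rewrite /des -sum1dep_card big_mkcond /=; under eq_bigr => i _ do rewrite desE.
rewrite big_ord_recr /= ltnn addn0; apply: eq_bigr => i _.
rewrite /= ltn_ord /= -[widen_ord _ i]inord_val /= /descent.
by rewrite ?inordK ?(ltn_trans (ltn_ord i)) //; case: ifP.
Qed.

Lemma pk_npk : pk s = npk descent m.
Proof.
have pkE (i : 'I_m.+1) : [exists h : 'I_m.+1, [exists j : 'I_m.+1,
    [&& i == h.+1 :> nat, j == i.+1 :> nat, (s h < s i)%N & (s j < s i)%N]]]
    = (i < m)%N && (if (i : nat) is i'.+1 then ~~ descent i' && descent i'.+1 else false).
  have iE : i = inord i by rewrite inord_val.
  apply/existsP/andP => [[h /existsP[j /and4P[/eqP def_i /eqP def_j hi ji]]]|[lt_im]].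
    have lt_im : (i < m)%N by rewrite -ltnS -def_j ltn_ord.
    split=> //; rewrite def_i in lt_im *; rewrite -ascentE ?(ltnW lt_im) // /descent -def_i -iE.
    have -> : inord h = h by rewrite inord_val.
    by rewrite hi /= (_ : inord i.+1 = j) //; apply: val_inj; rewrite /= -def_j inordK.
  case def_i: (i : nat) lt_im => [//|i'] lt_im; rewrite -ascentE ?(ltnW lt_im) //.
  rewrite /descent -def_i -iE => /andP[hi ji].
  exists (inord i'); apply/existsP; exists (inord i.+1).
  by rewrite hi ji !inordK ?def_i ?ltnS ?eqxx // ltnW // ltnW.
rewrite /pk -sum1dep_card big_mkcond /=; under eq_bigr => i _ do rewrite pkE.
rewrite big_ord_recr /= ltnn addn0; apply: eq_bigr => i _.
by rewrite /= ltn_ord /=; case: (nat_of_ord i) => [|i'] //; case: (_ && _).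
Qed.

(** By transitivity of [before], comparing adjacent positions is enough. *)
Lemma is_std_chain q (neg : nat -> bool) (v : {ffun 'I_m.+1 -> 'I_q}) :
  is_std (fun a : 'I_q => neg a) v s = chain neg descent [ffun i => v (s i)].
Proof.
have stepE i : (i < m)%N ->
    before (fun a : 'I_q => neg a) v (s (inord i)) (s (inord i.+1))
    = may_follow neg (descent i) (v (s (inord i))) (v (s (inord i.+1))).
  move=> lt_im; rewrite /before /may_follow -[v _ == v _](inj_eq val_inj) /=.
  case: ltngtP => //= ->; rewrite ascentE // -/(descent i).
  by case: (neg _) (descent i) => -[].
apply/forallP/forallP => [std_s i | chain_s i].
  rewrite !ffunE -stepE //; have /forallP/(_ (inord i.+1)) := std_s (inord i).
  by rewrite !inordK ?ltnS ?leqnn //= ltnW.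
apply/forallP=> j; apply/implyP.
rewrite -[i]inord_val -[j]inord_val !inordK //.
pose D : {pred nat} := fun i => (i < m.+1)%N.
apply: (@homo_ltn_in _ D (fun i => s (inord i)) (before (fun a : 'I_q => neg a) v)).
- by move=> b a c; apply: before_trans.
- by move=> a b _ lt_b c /andP[_ lt_c]; apply: (ltn_trans lt_c (lt_b : (b < m.+1)%N)).
- move=> a _ lt_a; rewrite stepE //; have := chain_s (Ordinal (lt_a : a < m)%N).
  by rewrite !ffunE.
- exact: ltn_ord.
- exact: ltn_ord.
Qed.

End Descents.

Section SignedSum.
Variables (R : comNzRingType) (y : R) (z : nat -> R).

Definition signed_sum n k : R :=
  word_sum (q := k.*2) (fun a => even_neg a) (fun a => letter_weight y a) z n.

Lemma signed_sum_chains m k : signed_sum m.+1 k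
  = \sum_(s : 'S_m.+1) cycle_weight z s
      * \sum_(a < k.*2) chain_end even_neg (letter_weight y) (descent s) m a.
Proof.
rewrite /signed_sum /word_sum.
rewrite (partition_big (fun v : {ffun 'I_m.+1 -> 'I_k.*2} =>
                          st (fun a : 'I_k.*2 => even_neg a) v) xpredT) //=.
apply: eq_bigr => s _; rewrite -sum_chain mulr_sumr.
rewrite [RHS](reindex (fun v : {ffun 'I_m.+1 -> 'I_k.*2} => [ffun i => v (s i)])) /=; last first.
  exists (fun w : {ffun 'I_m.+1 -> 'I_k.*2} => [ffun i => w ((s^-1)%g i)]) => v _;
    by apply/ffunP=> i; rewrite !ffunE ?permK ?permKV.
apply: eq_big => [v|v /eqP ->].
  by rewrite -is_std_chain; apply/eqP/idP => [/st_eqP|/st_eqP].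
rewrite mulrC; congr (_ * _); rewrite (reindex_inj (@perm_inj _ s)) /=.
by apply: eq_bigr => i _; rewrite ffunE.
Qed.

(** The numerator for a permutation with [p] peaks, [p + a] descents and [p + b]
    ascents. *)
Definition yX_poly (p a b : nat) : {fps R} :=
  fpsX ^+ p.+1 * (1 + fpsC y) ^+ (2 * p).+1 * (fpsC y + fpsX) ^+ a * (1 + fpsC y * fpsX) ^+ b.

Lemma signed_sum_gf n : (0 < n)%N ->
  (1 - fpsX) ^+ n.+1 * (\fps_ k signed_sum n k)
  = \sum_(s : 'S_n) fpsC (cycle_weight z s) * yX_poly (pk s) (des s - pk s) (n.-1 - (des s + pk s)).
Proof.
case: n => // m _.
have -> : (\fps_ k signed_sum m.+1 k) = \sum_(s : 'S_m.+1)
    fpsC (cycle_weight z s) * gf_total (chain_end even_neg (letter_weight y) (descent s) m).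
  apply: fpsP => k; rewrite coefs_sum [LHS]/= signed_sum_chains.
  by apply: eq_bigr => s _; rewrite coefsCM.
rewrite mulr_sumr; apply: eq_bigr => s _; rewrite mulrCA; congr (_ * _).
have [a [b [des_a m_b ->]]] := chain_gf y (descent s) m.
by rewrite des_ndes pk_npk /yX_poly; congr (_ * _ ^+ _ * _ ^+ _); rewrite ?des_a /=; lia.
Qed.

End SignedSum.

Lemma des_pk_bounds n (s : 'S_n) : (0 < n)%N -> exists a b,
  des s = (pk s + a)%N /\ n = (pk s + des s + b).+1.
Proof.
case: n s => // m s _; have [a [b [des_a m_b _]]] := chain_gf (0 : int) (descent s) m.
by exists a, b; rewrite des_ndes pk_npk; lia.
Qed.


HB.instance Definition _ (R : comNzRingType) :=
  GRing.RMorphism.copy (@fps2C R) (@fpsC {fps R} \o @fpsC R).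

(** * Exponentials and rational powers *)

Section Composition.
Variable R : comNzRingType.
Notation A := {fps R}.
Implicit Types (f h : {fps A}) (c : nat -> R).

(** Only the first [n] factors matter for the coefficient of index [n]. *)
Lemma coefs_iprod_logd (F E : nat -> {fps A}) n :
  (forall m, (1 <= m)%N -> ordX m (F m - 1)) ->
  (forall m, (1 <= m)%N -> logd (F m) (E m)) ->
  n%:R * coefs (\iprod_(m >= 1) F m) n = \sum_(j < n.+1)
    coefs (\sum_(1 <= m < n.+1) E m) j * coefs (\iprod_(m >= 1) F m) (n - j).
Proof.
move=> Ford FE; have FG := iprod_eqmod (n := n) Ford.
rewrite FG // (@coefs_logd _ _ (\sum_(1 <= m < n.+1) E m)).
  by apply: eq_bigr => j _; rewrite FG // leq_subr.
rewrite big_nat [X in logd _ X]big_nat; apply: logd_prod => m /andP[m_gt0 _].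
exact: FE.
Qed.

Definition compose c h : {fps A} := \isum_(j >= 0) fps2C (c j) * h ^+ j.

Lemma compose_ord c h j : ordX 1 h -> ordX j (fps2C (c j) * h ^+ j).
Proof. by move=> h1; apply: ordX_mulr; have := ordX_exp (i := j) h1; rewrite mul1n. Qed.

Lemma compose_eqmod c h n : ordX 1 h ->
  eqmodX n (compose c h) (\sum_(j < n.+1) fps2C (c j) * h ^+ j).
Proof.
move=> h1; rewrite -(big_mkord xpredT (fun j => fps2C (c j) * h ^+ j)).
by apply: isum_eqmod => j _; apply: compose_ord.
Qed.

Lemma compose_sub1 c h i : (0 < i)%N -> c 0%N = 1 -> ordX i h -> ordX i (compose c h - 1).
Proof.
move=> i_gt0 c0 hi j lt_ji; have h1 : ordX 1 h.
  by move=> l; rewrite ltnS leqn0 => /eqP->; apply: hi.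
rewrite coefsD coefsN (@compose_eqmod c h j) // big_ord_recl c0 rmorph1 mul1r expr0.
rewrite coefsD addrAC subrr add0r coefs_sum big1 // => l _.
suff /(_ j lt_ji) : ordX i (fps2C (c (lift ord0 l)) * h ^+ (lift ord0 l)) by [].
by rewrite /= exprSr mulrA; apply: ordX_mulr.
Qed.

(** The condition on [c] says that its series [C] satisfies the differential
    equation [C' (1 + b X) = a C]. This covers the exponential, for [a = 1] and
    [b = 0], and the power of exponent [a], for [b = 1]. *)
Lemma euler_compose (a b : R) c h : ordX 1 h ->
  (forall j, j.+1%:R * c j.+1 + b * (j%:R * c j) = a * c j) ->
  euler (compose c h) * (1 + fps2C b * h) = fps2C a * euler h * compose c h.
Proof.
move=> h1 ode; apply: fpsP => n.
pose S N := \sum_(j < N) fps2C (c j) * h ^+ j.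
have eqS N : (n < N)%N -> eqmodX n (compose c h) (S N).
  by case: N => // N lt_nN; apply: eqmodXW (@compose_eqmod c h N h1).
have eulerS N : euler (S N.+1) = \sum_(j < N) fps2C (j.+1%:R * c j.+1) * h ^+ j * euler h.
  rewrite euler_sum big_ord_recl eulerCM euler1 mulr0 add0r; apply: eq_bigr => j _.
  by rewrite eulerCM euler_exp rmorphM rmorph_nat /fps2C; ring.
have -> : coefs (euler (compose c h) * (1 + fps2C b * h)) n
    = coefs (euler (S n.+2) * (1 + fps2C b * h)) n.
  by apply: (@eqmodX_mul _ n) => // j le_jn; rewrite /= (eqS n.+2).
have -> : coefs (fps2C a * euler h * compose c h) n
    = coefs (fps2C a * euler h * S n.+1) n.
  by apply: (@eqmodX_mul _ n) => //; apply: eqS.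
have shift_sum N : \sum_(j < N) fps2C (j%:R * c j) * h ^+ j + fps2C (N%:R * c N) * h ^+ N
    = h * \sum_(j < N) fps2C (j.+1%:R * c j.+1) * h ^+ j.
  rewrite -(big_ord_recr N (fun j => fps2C (j%:R * c j) * h ^+ j)) big_ord_recl.
  rewrite /= mul0r rmorph0 mul0r add0r mulr_sumr; apply: eq_bigr => j _.
  by rewrite exprS mulrCA.
have -> : euler (S n.+2) * (1 + fps2C b * h)
   = fps2C a * euler h * S n.+1 + fps2C (b * (n.+1%:R * c n.+1)) * euler h * h ^+ n.+1.
  rewrite eulerS -mulr_suml; set D := \sum_(j < n.+1) _.
  have D_ode : D = fps2C a * S n.+1 - fps2C b * \sum_(j < n.+1) fps2C (j%:R * c j) * h ^+ j.
    rewrite /S !mulr_sumr -sumrB; apply: eq_bigr => j _.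
    by rewrite !mulrA -!rmorphM -mulrBl -rmorphB -ode addrK.
  transitivity (euler h * (D + fps2C b * (h * D))); first by ring.
  by rewrite -shift_sum {1}D_ode rmorphM; ring.
rewrite coefsD [X in _ + X](_ : _ = 0) ?addr0 //.
suff /(_ n (ltnSn n)) : ordX n.+1 (fps2C (b * (n.+1%:R * c n.+1)) * euler h * h ^+ n.+1) by [].
by apply: ordX_mulr; have := ordX_exp (i := n.+1) h1; rewrite mul1n.
Qed.

End Composition.

Lemma sum_divisors_nat (V : nmodType) (G : nat -> V) n N : (0 < N <= n)%N ->
  \sum_(1 <= i < n.+1) (if (i %| N)%N then G i else 0) = \sum_(i <- divisors N) G i.
Proof.
case/andP=> N_gt0 le_Nn; rewrite -big_mkcond -big_filter; apply: perm_big.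
apply: uniq_perm; rewrite ?filter_uniq ?iota_uniq ?divisors_uniq // => i.
rewrite mem_filter mem_index_iota -dvdn_divisors //.
case: (boolP (i %| N)%N) => //= i_N; rewrite (dvdn_gt0 N_gt0 i_N) /= ltnS.
exact: leq_trans (dvdn_leq N_gt0 i_N) le_Nn.
Qed.

Lemma binq0 a : binq a 0 = 1.
Proof. by rewrite /binq big_ord0 fact0 divr1. Qed.

Lemma binq_ode a j : j.+1%:R * binq a j.+1 + j%:R * binq a j = a * binq a j.
Proof.
have fact_neq0 i : i`!%:R != 0 :> rat by rewrite pnatr_eq0 -lt0n fact_gt0.
rewrite /binq big_ord_recr /= factS natrM invfM.
have jV : j.+1%:R != 0 :> rat by rewrite pnatr_eq0.
by rewrite [_ * (_ - _) * _]mulrCA mulVKf //; move: (_^-1) => u; ring.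
Qed.

Section RationalCoefficients.
Variables (R : comNzRingType) (phi : {rmorphism rat -> R}).
Implicit Types (f e : {fps2 R}).

Lemma ratr_fps2C (a : rat) : ratr a = fps2C (phi a) :> {fps2 R}.
Proof.
pose psi : {rmorphism rat -> {fps2 R}} := @fps2C R \o phi.
rewrite -[RHS]/(psi a) -[a in RHS]divq_num_den rmorphM fmorphV !rmorph_int.
by [].
Qed.

Lemma natV_fps2C n : n%:R^-1 = fps2C (phi n%:R^-1) :> {fps2 R}.
Proof.
pose psi : {rmorphism rat -> {fps2 R}} := @fps2C R \o phi.
by rewrite -(rmorph_nat psi) -fmorphV.
Qed.

Lemma nat_unit n : (0 < n)%N -> n%:R \is a @GRing.unit {fps2 R}.
Proof.
move=> n_gt0; pose psi : {rmorphism rat -> {fps2 R}} := @fps2C R \o phi.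
by rewrite -(rmorph_nat psi) rmorph_unit // unitfE pnatr_eq0 -lt0n.
Qed.

(** Dividing by [n] is possible after embedding the coefficients in the outer ring. *)
Lemma nat_inj n (c c' : {fps R}) : (0 < n)%N -> n%:R * c = n%:R * c' -> c = c'.
Proof.
move=> n_gt0 /(congr1 (@fpsC {fps R})); rewrite !rmorphM !rmorph_nat.
by move/(mulrI (nat_unit n_gt0))/(congr1 (fun f => coefs f 0)).
Qed.

Lemma expE f : fps2_exp f = compose (fun j => phi (j`!%:R^-1)) f.
Proof.
rewrite /fps2_exp /compose; congr (fps2_sum 0 _); apply/boolp.funext => j.
by rewrite natV_fps2C mulrC.
Qed.

Lemma powE f a : f ^^ a = compose (fun j => phi (binq a j)) (f - 1).
Proof.
rewrite /fps2_pow /compose; congr (fps2_sum 0 _); apply/boolp.funext => j.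
by rewrite ratr_fps2C.
Qed.

Lemma exp_sub1 f i : (0 < i)%N -> ordX i f -> ordX i (fps2_exp f - 1).
Proof.
by move=> i_gt0 fi; rewrite expE; apply: compose_sub1; rewrite // fact0 invr1 rmorph1.
Qed.

Lemma pow_sub1 f a i : (0 < i)%N -> ordX i (f - 1) -> ordX i (f ^^ a - 1).
Proof. by move=> i_gt0 fi; rewrite powE; apply: compose_sub1; rewrite // binq0 rmorph1. Qed.

Lemma logd_exp f : ordX 1 f -> logd (fps2_exp f) (euler f).
Proof.
move=> f1; have := euler_compose (a := 1) (b := 0) (c := fun j => phi (j`!%:R^-1)) f1.
rewrite -expE rmorph0 rmorph1 !mul0r addr0 mulr1 mul1r; apply=> j.
rewrite mul0r addr0 mul1r -(rmorph_nat phi) -rmorphM; congr (phi _).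
by rewrite factS natrM invfM mulVKf // pnatr_eq0.
Qed.

Lemma logd_pow f e a : ordX 1 (f - 1) -> f \is a GRing.unit -> logd f e ->
  logd (f ^^ a) (ratr a * e).
Proof.
move=> f1 f_unit fe.
have eulerB1 : euler (f - 1) = e * f.
  by rewrite -fe -mulN1r -(rmorphN1 (@fpsC _)) eulerD eulerCM euler1 mulr0 addr0.
have fE : 1 + fps2C 1 * (f - 1) = f by rewrite rmorph1 mul1r addrC subrK.
apply: (mulIr f_unit); transitivity (euler (f ^^ a) * (1 + fps2C 1 * (f - 1))); first by rewrite fE.
rewrite powE.
rewrite (euler_compose (a := phi a) f1) ?eulerB1 ?ratr_fps2C //; first by ring.
move=> j; rewrite mul1r -!(rmorph_nat phi) -!rmorphM -rmorphD; congr (phi _).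
exact: binq_ode.
Qed.

(** * The infinite products *)

Variables (y : R) (z : nat -> R).

(** This is [i] times the plethysm of the power sum of degree [m] with the
    Lie character of degree [i], for [k] letters of weight [1] and [k] negative
    letters of weight [y]. *)
Definition signed_primitive_sum k i m : R :=
  \sum_(d <- divisors i) (moebius d)%:~R * (k%:R * (1 - (- y) ^+ (d * m))) ^+ (i %/ d).

Lemma power_sum_signed k m :
  power_sum (fun a : 'I_k.*2 => even_neg a) (fun a : 'I_k.*2 => letter_weight y a) m
  = k%:R * (1 - (- y) ^+ m).
Proof.
rewrite /power_sum; elim: k => [|k IHk]; first by rewrite mul0r big_ord0.
rewrite doubleS !big_ord_recr /= IHk /even_neg /letter_weight /= odd_double /= mul1n mul0n expr0 expr1n.
rewrite (exprNn y) exprS -[k.+1]addn1 natrD; ring.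
Qed.

Lemma primitive_sumE k i m :
  primitive_sum (fun a : 'I_k.*2 => even_neg a) (fun a : 'I_k.*2 => letter_weight y a) i m
  = signed_primitive_sum k i m.
Proof. by apply: eq_bigr => d _; rewrite power_sum_signed. Qed.

Definition factor_logd k i : {fps2 R} := \fps_ N
  (if (0 < N)%N && (i %| N)%N then fpsC (z i ^+ (N %/ i) * signed_primitive_sum k i (N %/ i)) else 0).

(** The product and the word enumerator satisfy the same recurrence, which
    determines them because [n] can be cancelled. *)
Lemma coefs_iprod_words k (P : nat -> {fps2 R}) n :
  (forall i, (1 <= i)%N -> ordX i (P i - 1)) ->
  (forall i, (1 <= i)%N -> logd (P i) (factor_logd k i)) ->
  coefs (\iprod_(i >= 1) P i) n = fpsC (signed_sum y z n k).
Proof.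
move=> P1 PE; elim/ltn_ind: n => n IHn; have [->|n_gt0] := posnP n.
  by rewrite iprod_coefs // big_geq // /signed_sum word_sum0.
apply: (nat_inj n_gt0); rewrite (coefs_iprod_logd n P1 PE).
rewrite -(rmorph_nat (@fpsC R)) -rmorphM /signed_sum word_sum_rec rmorph_sum.
rewrite big_ord_recl coefs_sum big1 ?mul0r ?add0r // [RHS]big_add1 [n.+1.-1 in RHS]/= [RHS]big_mkord.
apply: eq_bigr => N _; rewrite coefs_sum rmorphM -/(signed_sum y z _ k).
rewrite IHn ?lift0 /bump /= ?add1n; last by rewrite ltn_subrL.
congr (_ * _); rewrite rmorph_sum -(@sum_divisors_nat _ _ n) ?ltn_ord //.
apply: eq_bigr => i _; rewrite /factor_logd /=.
by case: ifP => // _; rewrite primitive_sumE.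
Qed.

(** Here the sum over [k] converges through its powers of [t], whatever the orders
    in [x]; the coefficient of [t ^ k] comes from the [k]-th product alone. *)
Lemma isum_words (G : nat -> {fps2 R}) :
  (forall k n, coefs (G k) n = fpsC (signed_sum y z n k)) ->
  \isum_(k >= 0) fpst ^+ k * G k = \fps_ n \fps_ k signed_sum y z n k.
Proof.
move=> GE; apply: fps2_limE => n j; exists j.+1 => N lt_jN /=.
rewrite coefs_sum coefs_sum.
have termE k : coefs (coefs (fpst ^+ k * G k) n) j = if j == k then signed_sum y z n k else 0.
  rewrite /fpst -rmorphXn coefsCM GE mulrC coefsCM coefsXn.
  by case: ifP; rewrite ?mulr1 ?mulr0.
rewrite (eq_bigr _ (fun k _ => termE k)) big_mkord (bigD1 (Ordinal lt_jN)) //= eqxx.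
rewrite big1 ?addr0 // => k; rewrite -val_eqE /= eq_sym => /negPf neq_k.
by rewrite neq_k.
Qed.

End RationalCoefficients.

(** * The two sides of the identities *)

Section Sides.
Variables (R : comNzRingType) (phi : {rmorphism rat -> R}) (y : R) (z : nat -> R).
Local Notation t := (fpst : {fps2 R}).
Local Notation x := (fpsx : {fps2 R}).
Local Notation yv := (fps2C y : {fps2 R}).
Local Notation zv := (fun i => fps2C (z i) : {fps2 R}).

Lemma phi_nat (c : nat) : phi c%:R = c%:R. Proof. exact: rmorph_nat. Qed.

Definition exponent k i : {fps2 R} := \isum_(m >= 1) (zv i * x ^+ i) ^+ m / (i * m)%:R
  * (\sum_(d <- divisors i) (moebius d)%:~R * (k%:R * (1 - (- yv) ^+ (d * m))) ^+ (i %/ d)).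

Lemma exponent_termE k i m :
  (zv i * x ^+ i) ^+ m / (i * m)%:R
  * (\sum_(d <- divisors i) (moebius d)%:~R * (k%:R * (1 - (- yv) ^+ (d * m))) ^+ (i %/ d))
  = fps2C (phi (i * m)%:R^-1 * (z i ^+ m * signed_primitive_sum y k i m)) * x ^+ (i * m).
Proof.
have -> : \sum_(d <- divisors i) (moebius d)%:~R * (k%:R * (1 - (- yv) ^+ (d * m))) ^+ (i %/ d)
    = fps2C (signed_primitive_sum y k i m).
  rewrite rmorph_sum; apply: eq_bigr => d _.
  by rewrite rmorphM rmorph_int rmorphXn rmorphM rmorph_nat rmorphB rmorph1 rmorphXn rmorphN.
rewrite (natV_fps2C phi) !rmorphM rmorphXn exprMn -exprM.
by ring.
Qed.

Lemma exponent_term_ord k i m : (0 < i)%N -> ordX m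
  ((zv i * x ^+ i) ^+ m / (i * m)%:R
  * (\sum_(d <- divisors i) (moebius d)%:~R * (k%:R * (1 - (- yv) ^+ (d * m))) ^+ (i %/ d))).
Proof.
move=> i_gt0 j lt_jm; rewrite exponent_termE coefsCM coefsXn ltn_eqF ?mulr0 //.
by rewrite (leq_trans lt_jm) // leq_pmull.
Qed.

Lemma coefs_exponent k i N : (0 < i)%N ->
  coefs (exponent k i) N = \sum_(1 <= m < N.+1)
    fpsC (phi (i * m)%:R^-1 * (z i ^+ m * signed_primitive_sum y k i m)) * (N == i * m)%N%:R.
Proof.
move=> i_gt0; rewrite /exponent isum_coefs => [|m _]; last exact: exponent_term_ord.
by apply: eq_bigr => m _; rewrite exponent_termE coefsCM coefsXn.
Qed.

Lemma exponent_ord k i : (0 < i)%N -> ordX i (exponent k i).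
Proof.
move=> i_gt0 j lt_ji; rewrite coefs_exponent // big_nat big1 // => m /andP[m_gt0 _].
by rewrite ltn_eqF ?mulr0 // (leq_trans lt_ji) // leq_pmulr.
Qed.

Lemma euler_exponent k i : (0 < i)%N -> euler (exponent k i) = factor_logd y z k i.
Proof.
move=> i_gt0; apply: fpsP => N; rewrite [LHS]/= coefs_exponent // /factor_logd /=.
have [->|N_gt0] := posnP N; first by rewrite mul0r.
case: ifPn => [/dvdnP[M def_N]|i'N] /=; last first.
  rewrite big1 ?mulr0 // => m _; case: eqP i'N => [->|]; rewrite ?mulr0 //.
  by rewrite dvdn_mulr.
have M_gt0 : (0 < M)%N by move: N_gt0; rewrite def_N muln_gt0 => /andP[].
have le_MN : (M <= N)%N by rewrite def_N leq_pmulr.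
rewrite (bigD1_seq M) ?iota_uniq ?mem_index_iota ?M_gt0 ?ltnS //=.
rewrite big1 ?addr0 => [|m neq_m]; last first.
  by rewrite def_N [(M * i)%N]mulnC eqn_pmul2l // eq_sym (negPf neq_m) mulr0.
have -> : (N %/ i)%N = M by rewrite def_N mulnK.
rewrite [(i * M)%N]mulnC -def_N eqxx mulr1 -fpsC_nat -rmorphM; congr fpsC.
by rewrite mulrA -phi_nat -rmorphM mulfV ?rmorph1 ?mul1r // pnatr_eq0 -lt0n.
Qed.

Lemma isum_exp_words : \isum_(k >= 0) t ^+ k * (\iprod_(i >= 1) fps2_exp (exponent k i))
  = \fps_ n \fps_ k signed_sum y z n k.
Proof.
apply: isum_words => k n; apply: (coefs_iprod_words phi) => i i_gt0.
  by apply: (exp_sub1 phi) => //; apply: exponent_ord.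
rewrite -euler_exponent //; apply: (logd_exp phi).
by move=> j; rewrite ltnS leqn0 => /eqP->; apply: exponent_ord.
Qed.

Lemma words_gf n : (0 < n)%N ->
  fpsC (\fps_ k signed_sum y z n k) * (1 - t) ^+ n.+1
  = \sum_(s : 'S_n) t ^+ (pk s).+1 * (1 + yv) ^+ (2 * pk s).+1
      * (yv + t) ^+ (des s - pk s) * (1 + yv * t) ^+ (n.-1 - (des s + pk s)) * cycle_weight zv s.
Proof.
move=> n_gt0; rewrite mulrC -(rmorph1 (@fpsC {fps R})) -rmorphB -rmorphXn -rmorphM.
rewrite signed_sum_gf // rmorph_sum; apply: eq_bigr => s _; rewrite rmorphM mulrC.
congr (_ * _).
  by rewrite /yX_poly !rmorphM !rmorphXn !rmorphD rmorph1 rmorphM.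
by rewrite -[LHS]/(fps2C _) rmorph_prod; apply: eq_bigr => i _; rewrite rmorphXn.
Qed.

Definition words_pos : {fps2 R} :=
  \fps_ n (if n == 0%N then 0 else \fps_ k signed_sum y z n k).

Lemma isum_words_pos (B : nat -> {fps2 R}) c :
  (forall n, (0 < n)%N -> B n = fps2C c * fpsC (\fps_ k signed_sum y z n k)) ->
  \isum_(n >= 1) B n * x ^+ n = fps2C c * words_pos.
Proof.
move=> BE; apply: fpsP => n; rewrite isum_coefs => [|m _]; last first.
  exact/ordX_mulr/ordX_Xn.
transitivity (\sum_(1 <= m < n.+1)
    fpsC c * (\fps_ k signed_sum y z m k) * (n == m)%:R).
  rewrite big_nat [RHS]big_nat; apply: eq_bigr => m /andP[m_gt0 _].
  by rewrite BE // /fps2C -rmorphM coefsCM coefsXn.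
rewrite coefsCM [coefs words_pos n]/=; have [->|n_gt0] := posnP n.
  by rewrite big_geq // mulr0.
rewrite (bigD1_seq n) ?iota_uniq ?mem_index_iota ?n_gt0 ?ltnS //= eqxx mulr1.
rewrite big1 ?addr0 // => m neq_m.
by rewrite eq_sym (negPf neq_m) mulr0.
Qed.

Lemma sub1t_inv : (1 - t) * fpsC (geo 1 1) = 1.
Proof.
rewrite -(rmorph1 (@fpsC {fps R})) -rmorphB -rmorphM mulrC; congr fpsC.
by have := geo_inv (1 : R) (ltnSn 0); rewrite rmorph1 mul1r expr1.
Qed.

Lemma sub1t_unit : 1 - t \is a GRing.unit.
Proof. by apply/unitrPr; exists (fpsC (geo 1 1)); rewrite sub1t_inv. Qed.

Lemma lhs_words : (1 - t)^-1 + words_pos = \fps_ n \fps_ k signed_sum y z n k.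
Proof.
rewrite (_ : (1 - t)^-1 = fpsC (geo 1 1)); last first.
  by apply: (mulrI sub1t_unit); rewrite sub1t_inv mulrV ?sub1t_unit.
apply: fpsP => n; rewrite coefsD /=; have [->|n_gt0] := posnP n; last first.
  by rewrite add0r.
rewrite addr0; apply: fpsP => k /=.
by rewrite dvd1n expr1n /signed_sum word_sum0.
Qed.

End Sides.

(** The exponent is [n + 1 = (p + 1) + (p + a + 1) + b] for a permutation with [p]
    peaks and [p + a] descents; all but [b] of the factors [1 + y t] cancel. *)
Lemma pkdes_factor (U : comUnitRingType) (y t : U) p a b :
    1 - t \is a GRing.unit -> y + t \is a GRing.unit -> 1 + y * t \is a GRing.unit ->
  ((1 + y * t) / (1 - t)) ^+ (p + (p + a) + b).+2
    * (((1 + y) ^+ 2 * t / ((y + t) * (1 + y * t))) ^+ p.+1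
       * ((y + t) / (1 + y * t)) ^+ (p + a).+1) * (1 - t) ^+ (p + (p + a) + b).+2
  = (1 + y) * (t ^+ p.+1 * (1 + y) ^+ (2 * p).+1 * (y + t) ^+ a * (1 + y * t) ^+ b).
Proof.
move=> /mulVr; move: (1 - t) => w wV v_unit u_unit.
have vV := mulVr v_unit; have uV := mulVr u_unit; rewrite invrM //.
move: (y + t)^-1 (1 + y * t)^-1 w^-1 wV vV uV => v' u' w' wV vV uV.
have wX k : w' ^+ k * w ^+ k = 1 by rewrite -exprMn wV expr1n.
have uX k : u' ^+ k * (1 + y * t) ^+ k = 1 by rewrite -exprMn uV expr1n.
have vX k : v' ^+ k * (y + t) ^+ k = 1 by rewrite -exprMn vV expr1n.
move: (1 + y * t) (y + t) uX vX => u v uX vX {uV vV}.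
have -> : (p + (p + a) + b).+2 = (p.+1 + (p + a).+1 + b)%N by lia.
set N := (_ + _ + b)%N.
transitivity ((w' ^+ N * w ^+ N) * (u' ^+ p.+1 * u ^+ p.+1) * (u' ^+ (p + a).+1 * u ^+ (p + a).+1)
   * u ^+ b * (v' ^+ p.+1 * v ^+ p.+1) * v ^+ a * t ^+ p.+1 * ((1 + y) ^+ 2) ^+ p.+1).
  have -> : (p + a).+1 = (p.+1 + a)%N by [].
  by rewrite !exprMn /N !exprD; ring.
rewrite wX !uX vX -exprM mulnS !exprS; ring.
Qed.

Section Identities.
Variables (R : comNzRingType) (z : nat -> R).
Local Notation t := (fpst : {fps2 R}).
Local Notation x := (fpsx : {fps2 R}).
Local Notation zv := (fun i => fps2C (z i) : {fps2 R}).

Lemma add1Ct_unit (c : R) : 1 + fps2C c * t \is a GRing.unit.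
Proof.
suff: (1 + fps2C c * t) * fpsC (geo (- c) 1) = 1 by move=> cV; apply/unitrPr; exists (fpsC (geo (- c) 1)).
rewrite /fps2C /fpst -(rmorph1 (@fpsC {fps R})) -rmorphM -rmorphD -rmorphM mulrC.
by have := geo_inv (- c) (ltnSn 0); rewrite rmorphN mulNr opprK expr1 => ->.
Qed.

(** The inverse [y'] makes [y + t] invertible. *)
Lemma pkdes_gf (y y' : R) n : y * y' = 1 -> (0 < n)%N ->
  let yv := fps2C y in
  ((1 + yv * t) / (1 - t)) ^+ n.+1
    * Fpkdes n ((1 + yv) ^+ 2 * t / ((yv + t) * (1 + yv * t))) ((yv + t) / (1 + yv * t)) zv
  = fps2C (1 + y) * fpsC (\fps_ k signed_sum y z n k).
Proof.
move=> yV n_gt0 yv.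
have yt_unit : yv + t \is a GRing.unit.
  have -> : yv + t = yv * (1 + fps2C y' * t).
    by rewrite mulrDr mulr1 mulrA -rmorphM yV rmorph1 mul1r.
  rewrite unitrM add1Ct_unit andbT; apply/unitrPr; exists (fps2C y').
  by rewrite -rmorphM yV rmorph1.
apply: (mulIr (unitrX n.+1 (sub1t_unit R))).
rewrite -[RHS]mulrA words_gf // /Fpkdes mulr_sumr mulr_suml mulr_sumr.
apply: eq_bigr => s _; have [a [b [des_a n_b]]] := des_pk_bounds s n_gt0.
have -> : (des s - pk s = a)%N by lia.
have -> : (n.-1 - (des s + pk s) = b)%N by lia.
have -> : n.+1 = (pk s + (pk s + a) + b).+2 by lia.
rewrite des_a; have := pkdes_factor (pk s) a b (sub1t_unit R) yt_unit (add1Ct_unit y).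
rewrite -/yv rmorphD rmorph1 -/yv => fac.
by rewrite [_ * (_ * cycle_weight _ _)]mulrA mulrAC fac -!mulrA.
Qed.

(** At [y = 1] the ratio [(y + t) / (1 + y t)] is [1], and descents are ignored. *)
Lemma pk_gf n : (0 < n)%N ->
  ((1 + t) / (1 - t)) ^+ n.+1 * Fpk n (4 * t / (1 + t) ^+ 2) zv
  = fps2C (1 + 1) * fpsC (\fps_ k signed_sum 1 z n k).
Proof.
move=> n_gt0; have := @pkdes_gf 1 1 n (mulr1 1) n_gt0.
cbv zeta; move=> <-; rewrite rmorph1 mul1r.
have t_unit : 1 + t \is a GRing.unit by have := add1Ct_unit 1; rewrite rmorph1 mul1r.
suff -> : Fpk n (4 * t / (1 + t) ^+ 2) zv
    = Fpkdes n ((1 + 1) ^+ 2 * t / ((1 + t) * (1 + t))) ((1 + t) / (1 + t)) zv by [].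
have -> : (1 + 1) ^+ 2 = 4 :> {fps2 R} by ring.
by rewrite (divrr t_unit) /Fpkdes -[(1 + t) * (1 + t)]expr2; apply: eq_bigr => s _; rewrite expr1n mulr1.
Qed.

(** At [y = 0] the change of variables would divide by [t], but the numerator
    itself is [t ^ (des + 1)]. *)
Lemma des_gf n : (0 < n)%N ->
  Fdes n t zv / (1 - t) ^+ n.+1 = fps2C 1 * fpsC (\fps_ k signed_sum 0 z n k).
Proof.
move=> n_gt0; have tX_unit := unitrX n.+1 (sub1t_unit R).
apply: (mulIr tX_unit); rewrite (divrK tX_unit) (rmorph1 (@fps2C R)) mul1r (words_gf 0 z n_gt0).
apply: eq_bigr => s _; have [a [b [des_a n_b]]] := des_pk_bounds s n_gt0.
congr (_ * _); rewrite (rmorph0 (@fps2C R)) (mul0r t) (addr0 (1 : {fps2 R})) (add0r t).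
rewrite !expr1n; have -> : (des s).+1 = ((pk s).+1 + (des s - pk s))%N by lia.
by rewrite exprD; move: (t ^+ _) (t ^+ _) => u u'; ring.
Qed.

Variable phi : {rmorphism rat -> R}.

Lemma sub1zX_inv i : (0 < i)%N -> (1 - zv i * x ^+ i)^-1 = geo (fpsC (z i)) i.
Proof. by move=> i_gt0; apply: geoE. Qed.

Lemma geo_ord (c : {fps R}) i : (0 < i)%N -> ordX i (geo c i - 1).
Proof. by move=> i_gt0; rewrite geoB1 // mulrC; apply/ordX_mulr/ordX_mulr/ordX_Xn. Qed.

Lemma coefs_fpsCM_geo (a : R) (c : {fps R}) i N : (0 < i)%N ->
  coefs (fps2C a * (i%:R * (geo c i - 1))) N
  = if (0 < N)%N && (i %| N)%N then fpsC (a * i%:R) * c ^+ (N %/ i) else 0.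
Proof.
move=> i_gt0; rewrite coefsCM coefs_natM rmorphM rmorph_nat mulrA.
case: N => [|N]; first by rewrite geo_ord // mulr0.
by rewrite coefsD coefsN coefs1 subr0 /=; case: ifP; rewrite // mulr0.
Qed.

(** At [y = 0] the sum [signed_primitive_sum] no longer depends on [m], so that
    the exponential becomes a power of a geometric series. *)
Lemma des_factor k i : (0 < i)%N ->
  logd ((1 - zv i * x ^+ i)^-1 ^^ fexpo i k) (factor_logd 0 z k i).
Proof.
move=> i_gt0; rewrite sub1zX_inv //.
have -> : factor_logd 0 z k i
    = ratr (fexpo i k) * (i%:R * (geo (fpsC (z i)) i - 1)).
  rewrite (ratr_fps2C phi); apply: fpsP => N; rewrite coefs_fpsCM_geo //.
  rewrite /factor_logd [LHS]/=; case: ifP => // /andP[N_gt0 i_N].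
  rewrite -rmorphXn -rmorphM; congr fpsC; rewrite [RHS]mulrC; congr (_ * _).
  rewrite -(phi_nat phi) -rmorphM /fexpo mulrAC mulVf ?mul1r ?pnatr_eq0 -?lt0n //.
  rewrite /signed_primitive_sum rmorph_sum [LHS]big_seq [RHS]big_seq; apply: eq_bigr => d.
  rewrite -dvdn_divisors // => d_i; rewrite rmorphM rmorph_int rmorphXn rmorph_nat.
  have M_gt0 : (0 < d * (N %/ i))%N.
    by rewrite muln_gt0 (dvdn_gt0 i_gt0 d_i) divn_gt0 // dvdn_leq.
  by rewrite oppr0 expr0n gtn_eqF // subr0 mulr1.
apply: (logd_pow phi).
- by move=> j lt_j; apply: geo_ord => //; apply: leq_trans lt_j _.
- by rewrite -sub1zX_inv // unitrV; apply: geo_unit.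
- exact: logd_geo.
Qed.

Lemma pk_base_ord i : (0 < i)%N ->
  ordX i ((1 + zv i * x ^+ i) / (1 - zv i * x ^+ i) - 1).
Proof.
move=> i_gt0; rewrite sub1zX_inv //; set Z := zv i * x ^+ i.
have ZX (f : {fps2 R}) : ordX i (f * Z) by apply/ordX_mulr/ordX_mulr/ordX_Xn.
have -> : (1 + Z) * geo (fpsC (z i)) i - 1
    = geo (fpsC (z i)) i - 1 + geo (fpsC (z i)) i * Z.
  by move: (geo _ _) Z {ZX} => u u'; ring.
by move=> j lt_ji; rewrite coefsD (geo_ord _ i_gt0 lt_ji) (ZX _ j lt_ji) addr0.
Qed.

(** At [y = 1] the power sums of even degree vanish. Only the odd divisors and the
    odd powers of [z_i x^i] remain, as in the logarithm of the ratio. *)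
Lemma pk_factor k i : (0 < i)%N ->
  logd (((1 + zv i * x ^+ i) / (1 - zv i * x ^+ i)) ^^ gexpo i k) (factor_logd 1 z k i).
Proof.
move=> i_gt0.
have num_geo : 1 + zv i * x ^+ i = 1 - fpsC (- fpsC (z i)) * fpsX ^+ i.
  by rewrite rmorphN mulNr opprK.
rewrite sub1zX_inv // num_geo; set c := fpsC (z i).
have -> : factor_logd 1 z k i = ratr (gexpo i k)
    * (- i%:R * (geo (- c) i - 1) + i%:R * (geo c i - 1)).
  rewrite (ratr_fps2C phi); apply: fpsP => N; rewrite mulrDr mulNr mulrN addrC.
  have geoE e := coefs_fpsCM_geo (phi (gexpo i k)) e N i_gt0.
  rewrite [RHS](congr2 (fun u u' => u - u') (geoE c) (geoE (- c))).
  rewrite /factor_logd [LHS]/=; case: ifP => [/andP[N_gt0 i_N]|_]; last by rewrite subrr.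
  set M := (N %/ i)%N; rewrite -rmorphN -!rmorphXn -!rmorphM -rmorphB; congr fpsC.
  rewrite (exprNn (z i)).
  transitivity (z i ^+ M * (phi (gexpo i k) * i%:R * (1 - (-1) ^+ M))); last by ring.
  have signE d : (d %| i)%N -> (moebius d)%:~R * (k%:R * (1 - (-1) ^+ (d * M))) ^+ (i %/ d)
      = if odd d && odd M then phi ((moebius d)%:~R * (2 * k)%:R ^+ (i %/ d)) else 0.
    move=> d_i; have id_gt0 : (0 < i %/ d)%N by rewrite divn_gt0 ?(dvdn_gt0 i_gt0) // dvdn_leq.
    rewrite -signr_odd oddM; case: (_ && _).
      rewrite rmorphM rmorph_int rmorphXn rmorph_nat natrM; congr (_ * _ ^+ _).
      by rewrite expr1; ring.
    by rewrite expr0 subrr mulr0 expr0n gtn_eqF // mulr0.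
  congr (_ * _); transitivity (\sum_(d <- divisors i)
      if odd d && odd M then phi ((moebius d)%:~R * (2 * k)%:R ^+ (i %/ d)) else 0).
    rewrite /signed_primitive_sum [LHS]big_seq [RHS]big_seq; apply: eq_bigr => d.
    by rewrite -dvdn_divisors //; apply: signE.
  rewrite -(signr_odd _ M); case: (odd M); last first.
    by rewrite big1 ?expr0 ?subrr ?mulr0 // => d _; rewrite andbF.
  under eq_bigr => d _ do rewrite andbT.
  rewrite -big_mkcond -rmorph_sum expr1 opprK -[1 + 1]/(2%:R : R) -!(phi_nat phi) -!rmorphM.
  congr (phi _); rewrite /gexpo natrM.
  have i_neq0 : i%:R != 0 :> rat by rewrite pnatr_eq0 -lt0n.
  by field.
apply: (logd_pow phi).
- move=> j lt_j; rewrite -num_geo -sub1zX_inv //.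
  by apply: (pk_base_ord i_gt0); apply: leq_trans lt_j _.
- rewrite unitrM geo_unit //=; apply/unitrPr; exists (1 - fpsC c * fpsX ^+ i).
  exact: geo_inv.
- by apply: logd_mul; [apply: logd_geo_den | apply: logd_geo].
Qed.

End Identities.


Section MainIdentities.
Variables (R : comNzRingType) (z : nat -> R) (phi : {rmorphism rat -> R}).
Local Notation t := (fpst : {fps2 R}).
Local Notation x := (fpsx : {fps2 R}).
Local Notation zv := (fun i => fps2C (z i) : {fps2 R}).

Lemma pkdes_identity (y y' u : R) : y * y' = 1 -> (1 + y) * u = 1 ->
  let yv := fps2C y in
  (1 - t)^-1 + (1 + yv)^-1 * (\isum_(n >= 1) ((1 + yv * t) / (1 - t)) ^+ n.+1
      * Fpkdes n ((1 + yv) ^+ 2 * t / ((yv + t) * (1 + yv * t))) ((yv + t) / (1 + yv * t)) zv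
      * x ^+ n)
  = \isum_(k >= 0) t ^+ k * (\iprod_(i >= 1) fps2_exp (exponent y z k i)).
Proof.
move=> yV uV yv; rewrite (isum_exp_words phi) -lhs_words; congr (_ + _).
rewrite (isum_words_pos (fun n n_gt0 => pkdes_gf z yV n_gt0)).
rewrite rmorphD rmorph1 mulKr //; apply/unitrPr; exists (fps2C u).
by rewrite -[1 in LHS](rmorph1 (@fps2C R)) -rmorphD -rmorphM uV rmorph1.
Qed.

Lemma pk_identity :
  (1 - t)^-1 + 2^-1 * (\isum_(n >= 1) ((1 + t) / (1 - t)) ^+ n.+1
      * Fpk n (4 * t / (1 + t) ^+ 2) zv * x ^+ n)
  = \isum_(k >= 0) t ^+ k * (\iprod_(i >= 1)
      ((1 + zv i * x ^+ i) / (1 - zv i * x ^+ i)) ^^ gexpo i k).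
Proof.
rewrite (isum_words_pos (fun n n_gt0 => pk_gf z n_gt0)) rmorphD rmorph1.
rewrite mulKr; last exact: (nat_unit phi (ltn0Sn 1)).
rewrite lhs_words; apply/esym/isum_words => k n.
apply: (coefs_iprod_words phi) => i i_gt0; last exact: (pk_factor z phi).
apply: (pow_sub1 phi) => //; exact: pk_base_ord.
Qed.

Lemma des_identity :
  (1 - t)^-1 + \isum_(n >= 1) Fdes n t zv / (1 - t) ^+ n.+1 * x ^+ n
  = \isum_(k >= 0) t ^+ k * (\iprod_(i >= 1) (1 - zv i * x ^+ i)^-1 ^^ fexpo i k).
Proof.
rewrite (isum_words_pos (fun n n_gt0 => des_gf z n_gt0)) rmorph1 mul1r.
rewrite lhs_words; apply/esym/isum_words => k n.
apply: (coefs_iprod_words phi) => i i_gt0; last exact: (des_factor z phi).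
by apply: (pow_sub1 phi) => //; rewrite sub1zX_inv //; apply: geo_ord.
Qed.

End MainIdentities.

Theorem theorem7p1 :
  [/\ (* (a), over Q(y)[z_1, z_2, ...] *)
      let x : {fps2 (zpoly ratfun)} := fpsx in
      let t : {fps2 (zpoly ratfun)} := fpst in
      let y := yvar in
      (1 - t)^-1
      + (1 + y)^-1 * (\isum_(n >= 1)
          ((1 + y * t) / (1 - t)) ^+ n.+1
          * Fpkdes n ((1 + y) ^+ 2 * t / ((y + t) * (1 + y * t)))
                     ((y + t) / (1 + y * t)) zvar
          * x ^+ n)
      = \isum_(k >= 0) t ^+ k * (\iprod_(i >= 1) fps2_exp (\isum_(m >= 1)
          (zvar i * x ^+ i) ^+ m / (i * m)%:R
          * (\sum_(d <- divisors i)
               (moebius d)%:~R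
               * (k%:R * (1 - (- y) ^+ (d * m))) ^+ (i %/ d)))),
      (* (b), over Q[z_1, z_2, ...] *)
      let x : {fps2 (zpoly rat)} := fpsx in
      let t : {fps2 (zpoly rat)} := fpst in
      (1 - t)^-1
      + 2^-1 * (\isum_(n >= 1)
          ((1 + t) / (1 - t)) ^+ n.+1
          * Fpk n (4 * t / (1 + t) ^+ 2) zvar * x ^+ n)
      = \isum_(k >= 0) t ^+ k * (\iprod_(i >= 1)
          ((1 + zvar i * x ^+ i) / (1 - zvar i * x ^+ i)) ^^ gexpo i k)
    & (* (c), over Q[z_1, z_2, ...] *)
      let x : {fps2 (zpoly rat)} := fpsx in
      let t : {fps2 (zpoly rat)} := fpst in
      (1 - t)^-1
      + \isum_(n >= 1) Fdes n t zvar / (1 - t) ^+ n.+1 * x ^+ n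
      = \isum_(k >= 0) t ^+ k * (\iprod_(i >= 1)
          (1 - zvar i * x ^+ i)^-1 ^^ fexpo i k)].
Proof.
pose zK (K : comNzRingType) (i : nat) : zpoly K := << ucm i >>.
split; cbv zeta.
- pose phi : {rmorphism rat -> zpoly ratfun} := malgC \o (@tofrac {poly rat} \o @polyC rat).
  (* The constants [y] and [1 + y] have to be invertible. *)
  have X_neq0 : tofrac 'X != 0 :> ratfun by rewrite tofrac_eq0 polyX_eq0.
  have X1_neq0 : 1 + tofrac 'X != 0 :> ratfun.
    by rewrite -tofrac1 -tofracD tofrac_eq0 addrC -[1]/(1%:P) -size_poly_eq0 size_XaddC.
  have constV (c : ratfun) : c != 0 -> malgC c * malgC c^-1 = 1 :> zpoly ratfun.
    by move=> c_neq0; rewrite -rmorphM mulfV ?rmorph1.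
  apply: (@pkdes_identity _ (zK ratfun) phi (malgC (tofrac 'X))
            (malgC (tofrac 'X)^-1) (malgC (1 + tofrac 'X)^-1)).
    exact: constV X_neq0.
  by rewrite -(rmorph1 malgC) -rmorphD; apply: constV X1_neq0.
- exact: (@pk_identity _ (zK rat) malgC).
exact: (@des_identity _ (zK rat) malgC).
Qed.
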